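(* Let $\Theta$ be a finite simple irreducible graph with vertex set $V$. Let $H$ and $G$ be two graph products over $\Theta$, with nontrivial finitely generated vertex groups $\{H_v\}_{v\in V}$ and $\{G_v\}_{v\in V}$, respectively. Suppose that for each $v\in V$, $H_v$ strictly measurably imbeds into $G_v$, with coupling index $c_v$. Then $H$ strictly measurably imbeds into $G$ with coupling index $\infty$, unless all $c_v=1$, in which case the coupling index is also $1$.
   Context: All groups are discrete and countable, all measure spaces are standard, and all set equalities are almost everywhere equalities (the symmetric difference of the two sets is null). For a measure preserving action of a countable group $\Delta$ on $(\Sigma,\mu)$, a fundamental domain is a measurable set $Z\subset\Sigma$ with $\Sigma=\bigsqcup_{\delta\in\Delta}\delta Z$. A group $\Lambda$ strictly measurably imbeds (SMI) into a group $\Gamma$ if there exists an infinite measure space $(\Sigma,\mu)$ with a measurable, measure preserving action of $\Lambda\times\Gamma$, so that the actions of $\Lambda$ and of $\Gamma$ on $\Sigma$ admit Borel fundamental domains $Y$ and $X$ respectively, such that $X$ has finite measure and $X\subset Y$. The space $(\Sigma,\mu)$ is called an SMI-coupling, and its index (the coupling index) is $[\Gamma:\Lambda]_\Sigma := \mu(Y)/\mu(X)\in[1,\infty]$, which does not depend on the choices of the fundamental domains. To say that $\Lambda$ strictly measurably imbeds into $\Gamma$ with coupling index $c$ means that there is such an SMI-coupling of index $c$. A graph is simple if it has no edge loops and no multiple edges between vertices. Given a finite simple graph $\Theta$ with vertex set $V$ and groups $\{A_v\}_{v\in V}$, the graph product of the $A_v$ over $\Theta$ is the quotient of the free product of the $A_v$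 by the relations $[a,b]=e$ for all $a\in A_v$, $b\in A_u$ with $(v,u)$ an edge of $\Theta$; the $A_v$ are called the vertex groups. The join $\Theta_1\circ\Theta_2$ of two graphs is the graph obtained by connecting every vertex of $\Theta_1$ to every vertex of $\Theta_2$ with an edge (keeping all vertices and edges of $\Theta_1$ and $\Theta_2$). A graph $\Theta$ is irreducible if there is no pair of nonempty full subgraphs $\Theta_1,\Theta_2$ such that $\Theta=\Theta_1\circ\Theta_2$.
   Formalization: The graph is nonempty, and if it has a single vertex then its index c_v is assumed to be 1 or ∞; for one vertex with 1 < c_v < ∞ the claim fails, e.g. for a proper finite-index subgroup of SL_3(Z), whose coupling index is always the subgroup index. *)

(* Defs.v *)
From HB Require Import structures.
From mathcomp Require Import all_boot all_order all_algebra generic_quotient.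
From mathcomp Require Import all_classical all_reals all_analysis.

Set Implicit Arguments.
Unset Strict Implicit.
Unset Printing Implicit Defensive.

Local Open Scope quotient_scope.
Local Open Scope ring_scope.
Local Open Scope classical_set_scope.
Local Open Scope ereal_scope.
Local Open Scope group_scope.

Section Groups.
Variable G : groupType.

Definition nontrivial : Prop := exists x : G, x != 1.

Definition finitely_generated : Prop :=
  exists s : seq G, forall S : {pred G},
    group_closed S -> {subset s <= S} -> forall x, x \in S.

End Groups.

Section Graphs.
Variables (V : finType) (e : rel V).

(* The edge relation of the join of the full subgraphs of [e] on the disjoint
   vertex sets [A] and [B]. *)
Definition join_rel (A B : {set V}) : rel V := fun x y =>
  [|| [&& x \in A, y \in A & e x y], [&& x \in B, y \in B & e x y],
      (x \in A) && (y \in B) | (x \in B) && (y \in A)].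

Definition irreducible_graph : Prop :=
  ~ exists A B : {set V},
      [/\ A != finset.set0, B != finset.set0, A :&: B = finset.set0,
          A :|: B = finset.setTfor V & e =2 join_rel A B].

End Graphs.

Section GraphProduct.
Variables (V : finType) (e : rel V) (A : V -> groupType).

Definition gp_word : Type := seq {v : V & A v}.

Definition gp_letter (v : V) (a : A v) : {v : V & A v} := Tagged A a.

(* [gp_unit] and [gp_mul] present the free product of the [A v]; [gp_comm]
   adds the relations [a, b] = 1 along the edges. *)
Inductive gp_eq : gp_word -> gp_word -> Prop :=
| gp_refl w : gp_eq w w
| gp_sym w w' : gp_eq w w' -> gp_eq w' w
| gp_trans w w' w'' : gp_eq w w' -> gp_eq w' w'' -> gp_eq w w''
| gp_cat w1 w1' w2 w2' :
    gp_eq w1 w1' -> gp_eq w2 w2' -> gp_eq (w1 ++ w2) (w1' ++ w2')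
| gp_unit v : gp_eq [:: gp_letter (1 : A v)] [::]
| gp_mul v (a b : A v) :
    gp_eq [:: gp_letter a; gp_letter b] [:: gp_letter (a * b)]
| gp_comm v u (a : A v) (b : A u) : e v u ->
    gp_eq [:: gp_letter a; gp_letter b] [:: gp_letter b; gp_letter a].

Definition gp_eqb : rel gp_word := fun w w' => `[< gp_eq w w' >].

Fact gp_eqb_refl : reflexive gp_eqb.
Proof. by move=> w; apply/asboolP; exact: gp_refl. Qed.

Fact gp_eqb_sym : symmetric gp_eqb.
Proof. by move=> w w'; apply/asboolP/asboolP; exact: gp_sym. Qed.

Fact gp_eqb_trans : transitive gp_eqb.
Proof.
by move=> w' w w'' /asboolP h /asboolP h'; apply/asboolP; exact: gp_trans h h'.
Qed.

Canonical gp_equiv := EquivRel gp_eqb gp_eqb_refl gp_eqb_sym gp_eqb_trans.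

Definition graph_product : Type := {eq_quot gp_equiv}.
HB.instance Definition _ := Choice.on graph_product.

Definition gp_class (w : gp_word) : graph_product := \pi_{eq_quot gp_equiv} w.
Definition gp_repr (x : graph_product) : gp_word := repr (x : {eq_quot gp_equiv}).

Lemma gp_classP w w' : gp_class w = gp_class w' <-> gp_eq w w'.
Proof.
split=> [/eqmodP/asboolP //|h]; by apply/eqmodP/asboolP.
Qed.

Lemma gp_reprK x : gp_class (gp_repr x) = x.
Proof. exact: reprK. Qed.

Lemma gp_repr_class w : gp_eq (gp_repr (gp_class w)) w.
Proof. by apply/gp_classP; rewrite gp_reprK. Qed.

Definition gp_word_inv (w : gp_word) : gp_word :=
  rev [seq gp_letter ((tagged x : A (tag x))^-1) | x : {v : V & A v} <- w].

Definition gprod_one : graph_product := gp_class [::].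
Definition gprod_mul (x y : graph_product) : graph_product :=
  gp_class (gp_repr x ++ gp_repr y).
Definition gprod_inv (x : graph_product) : graph_product :=
  gp_class (gp_word_inv (gp_repr x)).

Fact gprod_mulA : associative gprod_mul.
Proof.
move=> x y z; apply/gp_classP.
apply: (@gp_trans _ (gp_repr x ++ (gp_repr y ++ gp_repr z))).
  by apply: gp_cat; [exact: gp_refl | exact: gp_repr_class].
by rewrite catA; apply: gp_cat; [exact/gp_sym/gp_repr_class | exact: gp_refl].
Qed.

Fact gprod_mul1g : left_id gprod_one gprod_mul.
Proof.
move=> x; rewrite -[RHS]gp_reprK; apply/gp_classP.
by rewrite -[X in gp_eq _ X]cat0s; apply: gp_cat;
  [exact: gp_repr_class | exact: gp_refl].
Qed.

Fact gprod_mulg1 : right_id gprod_one gprod_mul.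
Proof.
move=> x; rewrite -[RHS]gp_reprK; apply/gp_classP.
by rewrite -[X in gp_eq _ X]cats0; apply: gp_cat;
  [exact: gp_refl | exact: gp_repr_class].
Qed.

Lemma gp_word_mulV w : gp_eq (w ++ gp_word_inv w) [::].
Proof.
elim: w => [|[v a] w IHw]; first exact: gp_refl.
rewrite /gp_word_inv /= rev_cons -cats1 catA -cat_cons -cat1s -catA.
apply: gp_trans (gp_cat (gp_refl _) (gp_cat IHw (gp_refl _))) _.
apply: gp_trans (gp_mul a a^-1) _.
by rewrite mulgV; exact: gp_unit.
Qed.

Lemma gp_word_Vmul w : gp_eq (gp_word_inv w ++ w) [::].
Proof.
elim: w => [|[v a] w IHw]; first exact: gp_refl.
rewrite /gp_word_inv /= rev_cons -cats1 -catA -[_ :: w]cat1s (catA [:: _]).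
apply: gp_trans IHw; apply: gp_cat (gp_refl _) _.
rewrite -[X in gp_eq _ X]cat0s; apply: gp_cat (gp_refl _).
apply: gp_trans (gp_mul a^-1 a) _.
by rewrite mulVg; exact: gp_unit.
Qed.

Fact gprod_mulgV : right_inverse gprod_one gprod_inv gprod_mul.
Proof.
move=> x; apply/gp_classP/(gp_trans _ (gp_word_mulV (gp_repr x))).
by apply: gp_cat; [exact: gp_refl | exact: gp_repr_class].
Qed.

Fact gprod_mulVg : left_inverse gprod_one gprod_inv gprod_mul.
Proof.
move=> x; apply/gp_classP/(gp_trans _ (gp_word_Vmul (gp_repr x))).
by apply: gp_cat; [exact: gp_repr_class | exact: gp_refl].
Qed.

HB.instance Definition _ := isGroup.Build graph_product
  gprod_mulA gprod_mul1g gprod_mulg1 gprod_mulVg gprod_mulgV.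

End GraphProduct.

Section StandardBorel.
Variable R : realType.

Definition polish (P : metricType R) : Prop :=
  (forall F : set_system P, ProperFilter F -> cauchy F -> exists l : P, F --> l)
  /\ (exists2 D : set P, countable D & dense D).

(* [T] is Borel isomorphic, through [f], to a Borel subset of a Polish space. *)
Definition standard_borel d (T : measurableType d) : Prop :=
  exists (P : metricType R) (f : T -> P),
    [/\ polish P, injective f &
        forall A : set T, measurable A <-> <<s open >> (f @` A)].

End StandardBorel.

Section Couplings.
Variables (R : realType) (d : measure_display) (T : measurableType d).
Variable mu : {measure set T -> \bar R}.

Definition ae_eq_set (A B : set T) : Prop := mu.-negligible (A `+` B).

Definition ae_subset (A B : set T) : Prop := mu.-negligible (A `\` B).

Definition mp_action (G : groupType) (act : G -> T -> T) : Prop :=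
  [/\ forall x, act 1 x = x,
      forall g h x, act (g * h) x = act g (act h x),
      forall g, measurable_fun setT (act g) &
      forall g (A : set T), measurable A -> mu (act g @^-1` A) = mu A].

Definition fundamental_domain (G : groupType) (act : G -> T -> T)
    (Z : set T) : Prop :=
  [/\ measurable Z,
      ae_eq_set setT (\bigcup_g (act g @` Z)) &
      forall g h, g != h -> ae_eq_set (act g @` Z `&` act h @` Z) set0].

End Couplings.

(* [L] strictly measurably imbeds into [G] with coupling index [c].  For [G]
   countable, [mu setT = +oo] forces [mu X] to be nonzero, so the quotient of
   extended reals is the usual one. *)
Definition SMI (R : realType) (L G : groupType) (c : \bar R) : Prop :=
  exists (d : measure_display) (T : measurableType d)
         (mu : {sigma_finite_measure set T -> \bar R})
         (act : (L * G)%type -> T -> T) (Y X : set T),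
    [/\ standard_borel R T, mu setT = +oo%E & mp_action mu act] /\
    [/\ fundamental_domain mu (fun l : L => act (l, 1)) Y,
        fundamental_domain mu (fun g : G => act (1, g)) X,
        (mu X < +oo)%E, ae_subset mu X Y & c = (mu Y / mu X)%E].

(* Main.v *)
Require Import Defs.
From HB Require Import structures.
From mathcomp Require Import all_boot all_order all_algebra.
From mathcomp Require Import all_classical all_reals all_analysis.

(* Strict measurable imbeddings of [L] into [G] are turned into embedding
   cocycles: a probability measure preserving action of [L] on [T] and a cocycle
   [ga : L -> T -> G] with [ga l x = 1] only for [l = 1], given on [T = Sigma / G]
   by moving [l x] back into [X]; the coupling index is [1] exactly when the maps
   [ga(., x)] are onto. Conversely such a cocycle makes [L * G] act on [T * G],
   with [G]-fundamental domain [T * 1], and any set containing [T * 1] and meeting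
   each [L]-orbit at most once extends to an [L]-fundamental domain.

   The graph product [H] acts on the product of the spaces [T v], each [H v] moving
   the coordinate [v] only, and the cocycles [ga v] assemble to a cocycle [H -> G]
   because [ga v] does not see the coordinates of the neighbours of [v]. It is
   injective because the inverse cocycles assemble in the same way.
   If some [ga v (., x)] misses [g] for [x] in a set [B] of positive measure,
   choose [u] distinct from [v] and not adjacent to it: the points of [B * {w g}],
   with [w <> 1] in the infinite group [G u], lie in different [H]-orbits, so the
   index is infinite. *)

Set Implicit Arguments.
Unset Strict Implicit.
Unset Printing Implicit Defensive.

Import Order.TTheory GRing.Theory Num.Theory.
Import numFieldTopology.Exports numFieldNormedType.Exports.

Local Open Scope ring_scope.
Local Open Scope classical_set_scope.
Local Open Scope ereal_scope.
Local Open Scope group_scope.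

(** The vertex couplings are not multiplied directly, since their product would carry the direct
    products of the groups. Cocycles live on probability spaces, which can be multiplied, and the
    graph product enters on the side of the values, where letters at adjacent vertices commute. An
    action of a graph product is obtained by checking the defining relations for the letters, and
    these must hold at every point. Hence null sets are disposed of at once: the fundamental domains
    are made exact off an invariant null set, and outside a conull invariant set [D] the action is
    the identity and the cocycle is trivial, so that injectivity alone is confined to [D]. The
    groups [G u] are infinite because finitely many translates of the set [X] of finite measure
    cannot fill a space of infinite measure. Non-adjacency of [u] and [v] keeps the letter [w] of
    [w g] in front of [g]; at adjacent vertices the two letters could be exchanged. *)

Section DependentUpdate.
Variables (I : eqType) (T : I -> Type).
Implicit Types s : forall i, T i.

Lemma dfwith_id s i : eqtype.dfwith s (s i) = s.
Proof. by apply/functional_extensionality_dep => j; case: eqtype.dfwithP. Qed.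

Lemma dfwith_dfwith s i (x y : T i) : eqtype.dfwith (eqtype.dfwith s x) y = eqtype.dfwith s y.
Proof.
apply/functional_extensionality_dep => j.
by case: eqtype.dfwithP => [|k ik]; rewrite ?dfwith_in ?dfwith_out.
Qed.

Lemma dfwithC s i j (x : T i) (y : T j) : i != j ->
  eqtype.dfwith (eqtype.dfwith s x) y = eqtype.dfwith (eqtype.dfwith s y) x.
Proof.
move=> ij; apply/functional_extensionality_dep => k.
have [<-|ik] := eqVneq i k.
  by rewrite dfwith_in dfwith_out 1?eq_sym// dfwith_in.
rewrite [RHS]dfwith_out//; have [<-|jk] := eqVneq j k.
  by rewrite !dfwith_in.
by rewrite !dfwith_out.
Qed.

End DependentUpdate.

(** * Graph products: generators, induction, actions given on letters *)

Section GraphProductGenerators.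
Variables (V : finType) (e : rel V) (A : V -> groupType).
Local Notation GP := (graph_product e A).

Definition gp_gen (v : V) (a : A v) : GP := gp_class e [:: gp_letter a].

Lemma gp_class_cat (w w' : gp_word A) :
  gp_class e (w ++ w') = gp_class e w * gp_class e w'.
Proof. by apply/gp_classP/gp_cat; apply/gp_sym/gp_repr_class. Qed.

Lemma gp_gen1 v : gp_gen (1 : A v) = 1.
Proof. by apply/gp_classP/gp_unit. Qed.

Lemma gp_genM v (a b : A v) : gp_gen (a * b) = gp_gen a * gp_gen b.
Proof. by rewrite -gp_class_cat; apply/esym/gp_classP/gp_mul. Qed.

Lemma gp_genV v (a : A v) : gp_gen a^-1 = (gp_gen a)^-1.
Proof. by apply/esym/mulg1_eq; rewrite -gp_genM mulgV gp_gen1. Qed.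

Lemma gp_genC v u (a : A v) (b : A u) : e v u ->
  gp_gen a * gp_gen b = gp_gen b * gp_gen a.
Proof. by move=> evu; rewrite -!gp_class_cat; apply/gp_classP/gp_comm. Qed.

Lemma graph_product_ind (P : GP -> Prop) : P 1 ->
  (forall v (a : A v) w, P w -> P (gp_gen a * w)) -> forall w, P w.
Proof.
move=> P1 PM w; rewrite -(gp_reprK w); elim: (gp_repr w) => [//|[v a] l IHl].
by rewrite -cat1s gp_class_cat; exact: PM.
Qed.

Lemma graph_product_rind (P : GP -> Prop) : P 1 ->
  (forall v (a : A v) w, P w -> P (w * gp_gen a)) -> forall w, P w.
Proof.
move=> P1 PM w; rewrite -(gp_reprK w); elim/last_ind: (gp_repr w) => [//|l [v a] IHl].
by rewrite -cats1 gp_class_cat; exact: PM.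
Qed.

Section Action.
Variables (X : Type) (f : forall v, A v -> X -> X).
Arguments f : clear implicits.

Definition gp_act (w : GP) (x : X) : X :=
  foldr (fun l => f (tag l) (tagged l)) x (gp_repr w).

Hypothesis f1 : forall v x, f v 1 x = x.
Hypothesis fM : forall v a b x, f v (a * b) x = f v a (f v b x).
Hypothesis fC : forall v u a b x, e v u -> f v a (f u b x) = f u b (f v a x).

(** [gp_act] reads the chosen representative word. The hypotheses [f1], [fM], [fC] make the fold
    invariant under the three relations of [gp_eq], so any word of the class gives the same
    result. *)
Lemma gp_act_class l x :
  gp_act (gp_class e l) x = foldr (fun l => f (tag l) (tagged l)) x l.
Proof.
rewrite /gp_act; have := gp_repr_class e l.
move: (gp_repr _) => w; move=> ww'; elim: ww' x => {w l}.
- by [].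
- by move=> w w' _ IH x; rewrite IH.
- by move=> w w' w'' _ IH _ IH' x; rewrite IH IH'.
- by move=> w1 w1' w2 w2' _ IH _ IH' x; rewrite !foldr_cat IH IH'.
- by move=> v x; rewrite /= f1.
- by move=> v a b x; rewrite /= fM.
- by move=> v u a b evu x; rewrite /= fC.
Qed.

Lemma gp_act1 x : gp_act 1 x = x.
Proof. exact: gp_act_class. Qed.

Lemma gp_actM w w' x : gp_act (w * w') x = gp_act w (gp_act w' x).
Proof.
by rewrite -(gp_reprK w) -(gp_reprK w') -gp_class_cat !gp_act_class foldr_cat.
Qed.

Lemma gp_act_gen v (a : A v) x : gp_act (gp_gen a) x = f v a x.
Proof. exact: gp_act_class. Qed.

End Action.

(* A letter [a] at [v] multiplies the coordinate [s v] when [s] is trivial at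
   every other vertex not adjacent to [v], and does nothing otherwise. Adjacent
   letters commute because the condition at [v] ignores the neighbours of [v].
   The action of the words below on the trivial family replaces the normal form
   theorem. *)
Section Blocking.
Hypotheses (e_sym : symmetric e) (e_irr : irreflexive e).
Implicit Types s : forall v, A v.

Definition unblocked v s : bool :=
  [forall u, (u != v) && ~~ e v u ==> (s u == 1)].

Definition blocked_mul v (a : A v) s : forall v, A v :=
  if unblocked v s then eqtype.dfwith s (a * s v) else s.

Lemma unblocked_dfwith v u s (x : A u) : (u == v) || e v u ->
  unblocked v (eqtype.dfwith s x) = unblocked v s.
Proof.
move=> uv; apply: eq_forallb => w; case: (eqVneq u w) => [<-|uw].
  by case/orP: uv => ->; rewrite ?andbF.
by rewrite dfwith_out.
Qed.

Lemma blocked_mul1 v s : blocked_mul (1 : A v) s = s.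
Proof. by rewrite /blocked_mul mul1g dfwith_id if_same. Qed.

Lemma blocked_mulM v (a b : A v) s :
  blocked_mul (a * b) s = blocked_mul a (blocked_mul b s).
Proof.
rewrite /blocked_mul; case: ifPn => us.
  by rewrite unblocked_dfwith ?eqxx// us dfwith_in dfwith_dfwith mulgA.
by rewrite (negPf us).
Qed.

Lemma blocked_mulC v u (a : A v) (b : A u) s : e v u ->
  blocked_mul a (blocked_mul b s) = blocked_mul b (blocked_mul a s).
Proof.
move=> evu; have vu : v != u by apply: contraTneq evu => ->; rewrite e_irr.
have uv : u != v by rewrite eq_sym.
have euv : e u v by rewrite e_sym.
rewrite /blocked_mul; case: (boolP (unblocked u s)) => us;
  case: (boolP (unblocked v s)) => vs;
  rewrite ?unblocked_dfwith ?evu ?euv ?orbT// ?us ?(negPf us) ?vs ?(negPf vs)//.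
by rewrite dfwithC// !dfwith_out.
Qed.

Let one : forall v, A v := fun=> 1.
Local Notation bact := (gp_act blocked_mul).
Let bact_gen v (a : A v) := gp_act_gen blocked_mul1 blocked_mulM blocked_mulC a.
Let bactM := gp_actM blocked_mul1 blocked_mulM blocked_mulC.

Lemma blocked_mul_trivial v (a : A v) :
  blocked_mul a one = eqtype.dfwith one a.
Proof.
rewrite /blocked_mul mulg1 ifT//; apply/forallP => u.
by rewrite eqxx implybT.
Qed.

Lemma gp_gen_inj v : injective (@gp_gen v).
Proof.
move=> a b /(congr1 (fun w => bact w one v)).
by rewrite !bact_gen !blocked_mul_trivial !dfwith_in.
Qed.

Lemma blocked_mul_blocked v u (a : A v) (b : A u) : u != v -> ~~ e v u ->
  b != 1 -> blocked_mul a (eqtype.dfwith one b) = eqtype.dfwith one b.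
Proof.
move=> uv evu b1; rewrite /blocked_mul ifF//.
by apply/negbTE/forallPn; exists u; rewrite uv evu/= dfwith_in.
Qed.

(** Both sides are applied to the trivial family and read at [u]. On the left a nontrivial [b]
    blocks [m] and remains visible. On the right [c] acts first and blocks [b'], so the coordinate
    at [u] stays trivial. *)
Lemma gp_gen_separated v u (m a : A v) (b b' : A u) (c : A v) :
  u != v -> ~~ e v u -> c != 1 ->
  gp_gen m * gp_gen b = gp_gen a * gp_gen b' * gp_gen c -> b = 1.
Proof.
move=> uv evu c1; have vu : v != u by rewrite eq_sym.
have euv : ~~ e u v by rewrite e_sym.
move=> /(congr1 (fun w => bact w one u)).
rewrite !bactM !bact_gen !blocked_mul_trivial; have [//|b1] := eqVneq b 1.
rewrite blocked_mul_blocked// (blocked_mul_blocked _ _ euv)// => /eqP.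
rewrite dfwith_in /blocked_mul; case: ifP => _; last by rewrite dfwith_out// => /eqP.
by rewrite dfwith_out// dfwith_out// => /eqP.
Qed.

End Blocking.

End GraphProductGenerators.
Arguments gp_gen {V} e {A v} a.

(** The algebraic laws are asked at every point, so that letters can define a genuine action of a
    graph product. Injectivity is asked on the invariant set [D], which will be conull. *)
Record embedding_cocycle (T : Type) (L G : groupType) (a : L -> T -> T)
    (ga : L -> T -> G) (D : set T) : Prop := EmbeddingCocycle {
  ec_act1 : forall x, a 1 x = x ;
  ec_actM : forall l l' x, a (l * l') x = a l (a l' x) ;
  ec_cocycle : forall l l' x, ga (l * l') x = ga l (a l' x) * ga l' x ;
  ec_invariant : forall l x, D x -> D (a l x) ;
  ec_inj : forall l x, D x -> ga l x = 1 -> l = 1 }.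

Section EmbeddingCocycle.
Variables (T : pointedType) (L G : groupType) (a : L -> T -> T).
Variables (ga : L -> T -> G) (D : set T).
Hypothesis ec : embedding_cocycle a ga D.

Lemma ec_cocycle1 x : ga 1 x = 1.
Proof.
apply: (@mulgI _ (ga 1 x)); rewrite mulg1.
by rewrite /= -{1}(ec_act1 ec x) -(ec_cocycle ec) mulg1.
Qed.

Definition cocycle_act (l : L) (z : T * G) : T * G :=
  (a l z.1, z.2 * (ga l z.1)^-1).

Lemma cocycle_actM l l' z :
  cocycle_act (l * l') z = cocycle_act l (cocycle_act l' z).
Proof.
by rewrite /cocycle_act/= (ec_actM ec) (ec_cocycle ec) invgM mulgA.
Qed.

Lemma cocycle_act1 z : cocycle_act 1 z = z.
Proof.
by case: z => x g; rewrite /cocycle_act/= (ec_act1 ec) ec_cocycle1 invg1 mulg1.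
Qed.

Lemma cocycle_act_free l l' z : D z.1 ->
  cocycle_act l z = cocycle_act l' z -> l = l'.
Proof.
move=> Dz /(congr1 (cocycle_act l'^-1)); rewrite -!cocycle_actM mulVg cocycle_act1.
case: z Dz => x g /= Dx [_ /(congr1 (fun z => g^-1 * z))].
rewrite mulKg mulVg => /(congr1 (fun z => z^-1)); rewrite invgK invg1.
by move=> /(ec_inj ec Dx) /mulg1_eq; rewrite invgK.
Qed.

Let orbit (z : T * G) : set (T * G) := range (cocycle_act^~ z).

Let orbit_act l z : orbit (cocycle_act l z) = orbit z.
Proof.
apply/seteqP; split=> [_ [l' _ <-]|_ [l' _ <-]].
  by exists (l' * l); rewrite // cocycle_actM.
by exists (l' / l); rewrite // -cocycle_actM mulgVK.
Qed.

(** [rep] depends on [z] through its orbit, hence is constant on orbits. It prefers a point over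
    [1], which injectivity makes unique when the orbit lies over [D]. It is a bare choice without
    measurability, which suffices because the sections serve pointwise arguments. *)
Let rep (z : T * G) : T * G :=
  if pselect (exists z', orbit z z' /\ z'.2 = 1) is left _
  then xget (point, 1) [set z' | orbit z z' /\ z'.2 = 1]
  else xget (point, 1) (orbit z).

Let repP z : orbit z (rep z).
Proof.
rewrite /rep; case: pselect => [[z' z'P]|_].
  by case: (xgetPex (point, 1) (ex_intro [set z' | orbit z z' /\ z'.2 = 1] _ z'P)).
by apply: xgetPex; exists z, 1; rewrite // cocycle_act1.
Qed.

Let rep1 x : D x -> rep (x, 1) = (x, 1).
Proof.
move=> Dx; have xP : orbit (x, 1) (x, 1) /\ (x, 1 : G).2 = 1.
  by split=> //; exists 1; rewrite // cocycle_act1.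
rewrite /rep; case: pselect => [ex|[]]; last by exists (x, 1).
have [[l _ <-]] := xgetPex (point, 1) (ex_intro [set z' | orbit (x, 1) z' /\ z'.2 = 1] _ xP).
rewrite /= mul1g => /(congr1 (fun z => z^-1)); rewrite invgK invg1 => /(ec_inj ec Dx) ->.
by rewrite cocycle_act1.
Qed.

(* [rho] trivializes the free action of [L] on [D * G], with fundamental domain
   containing [D * 1]. *)
Lemma cocycle_section : exists rho : T * G -> L,
  (forall x, D x -> rho (x, 1) = 1) /\
  (forall l z, D z.1 -> rho (cocycle_act l z) = l * rho z).
Proof.
pose rho z := xget (1 : L) [set l | cocycle_act l (rep z) = z].
have rhoP z : cocycle_act (rho z) (rep z) = z.
  have [l _ lz] := repP z.
  apply: (xgetPex 1 (ex_intro [set l | cocycle_act l (rep z) = z] l^-1 _)).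
  by rewrite /= -lz -cocycle_actM mulVg cocycle_act1.
have rep_act l z : rep (cocycle_act l z) = rep z by rewrite /rep orbit_act.
have Drep z : D z.1 -> D (rep z).1.
  by have [l _ <-] := repP z; exact: (ec_invariant ec).
exists rho; split=> [x Dx|l z Dz].
  apply: (@cocycle_act_free _ _ (x, 1)) => //.
  by have := rhoP (x, 1); rewrite rep1 // cocycle_act1.
apply: (@cocycle_act_free _ _ (rep z)); first exact: Drep.
by rewrite cocycle_actM rhoP -(rep_act l) rhoP.
Qed.

End EmbeddingCocycle.

(** * The cocycle of the graph products and its inverse *)

Section GraphProductCocycle.
Variables (V : finType) (e : rel V) (e_sym : symmetric e) (e_irr : irreflexive e).
Variables (H G : V -> groupType) (T : V -> pointedType).
Variables (a : forall v, H v -> T v -> T v) (ga : forall v, H v -> T v -> G v).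
Variable D : forall v, set (T v).
Arguments D : clear implicits.
Hypothesis ec : forall v, embedding_cocycle (a (v := v)) (ga (v := v)) (D v).
Variables (X : Type) (A : forall v, H v -> X -> X) (pr : forall v, X -> T v).
Hypothesis A1 : forall v x, A (1 : H v) x = x.
Hypothesis AM : forall v (h h' : H v) x, A (h * h') x = A h (A h' x).
Hypothesis AC : forall v u (h : H v) (k : H u) x, v != u ->
  A h (A k x) = A k (A h x).
Hypothesis prA : forall v (h : H v) x, pr v (A h x) = a h (pr v x).
Hypothesis prA_out : forall v u (h : H v) x, v != u -> pr u (A h x) = pr u x.

Local Notation GP := (graph_product e G).
Local Notation HP := (graph_product e H).

Definition letter_act v (h : H v) (z : X * GP) : X * GP :=
  (A h z.1, z.2 * (gp_gen e (ga h (pr v z.1)))^-1).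

Let edge_neq v u : e v u -> v != u.
Proof. by apply: contraTneq => ->; rewrite e_irr. Qed.

Lemma letter_act1 v z : letter_act (1 : H v) z = z.
Proof.
case: z => x k; rewrite /letter_act/= A1 (ec_cocycle1 (ec v)) gp_gen1.
by rewrite invg1 mulg1.
Qed.

Lemma letter_actM v (h h' : H v) z :
  letter_act (h * h') z = letter_act h (letter_act h' z).
Proof.
rewrite /letter_act/= AM prA (ec_cocycle (ec v)) gp_genM.
by rewrite invgM mulgA.
Qed.

(** The space actions at distinct vertices commute, and neither letter alters the coordinate from
    which the cocycle of the other is read. The edge serves to commute the two values in [GP]. *)
Lemma letter_actC v u (h : H v) (k : H u) z : e v u ->
  letter_act h (letter_act k z) = letter_act k (letter_act h z).
Proof.
move=> evu; have vu := edge_neq evu; have uv : u != v by rewrite eq_sym.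
rewrite /letter_act/= AC// !prA_out// -!mulgA -!invgM.
by rewrite (gp_genC _ _ evu).
Qed.

Definition coupling_act : HP -> X * GP -> X * GP := gp_act letter_act.

Lemma coupling_act1 z : coupling_act 1 z = z.
Proof. exact: gp_act1 letter_act1 letter_actM letter_actC _. Qed.

Lemma coupling_actM h h' z :
  coupling_act (h * h') z = coupling_act h (coupling_act h' z).
Proof. exact: gp_actM letter_act1 letter_actM letter_actC _ _ _. Qed.

Lemma coupling_act_gen v (h : H v) z : coupling_act (gp_gen e h) z = letter_act h z.
Proof. exact: gp_act_gen letter_act1 letter_actM letter_actC _ _ _. Qed.

Lemma coupling_act_mull h k x k' :
  coupling_act h (x, k' * k) =
  ((coupling_act h (x, k)).1, k' * (coupling_act h (x, k)).2).
Proof.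
elim/graph_product_ind: h => [|v h w IHw]; first by rewrite !coupling_act1.
by rewrite !coupling_actM !coupling_act_gen IHw /letter_act/= mulgA.
Qed.

Definition all_good (x : X) : Prop := forall v, D v (pr v x).

Lemma letter_all_good v (h : H v) x : all_good x -> all_good (A h x).
Proof.
move=> gx u; have [<-|vu] := eqVneq v u; last by rewrite prA_out.
by rewrite prA; exact: (ec_invariant (ec v)).
Qed.

Lemma coupling_act_good h z : all_good z.1 -> all_good (coupling_act h z).1.
Proof.
elim/graph_product_ind: h => [|v h w IHw] gz; first by rewrite coupling_act1.
by rewrite coupling_actM coupling_act_gen; apply: letter_all_good; exact: IHw.
Qed.

(* The inverse cocycle: [G] acts on [prod_v (T v * G v)], and the sections
   [rho] turn this into a cocycle with values in [H]; it recovers [h] from the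
   value of the cocycle at [h], which gives injectivity without the normal form
   theorem for graph products. *)
Section InverseCocycle.
Variable rho : forall v, T v * G v -> H v.
Hypothesis rho1 : forall v x, D v x -> rho (x, 1) = 1.
Hypothesis rhoM : forall v l z, D v z.1 ->
  rho (cocycle_act (a (v := v)) (ga (v := v)) l z) = l * rho z.

Let Z := ((forall v, T v * G v) * HP)%type.

Let translate v (g : G v) (z : T v * G v) : T v * G v := (z.1, g * z.2).

(** The factor is the cocycle of [G v] acting on the [H v]-orbits, computed with the section [rho].
    At [(x, 1)] with [x] in [D] and [g = ga l x] it equals [l], because [(x, ga l x)] is [l^-1]
    applied to [(a l x, 1)]. *)
Definition inverse_letter v (g : G v) (z : Z) : Z :=
  (eqtype.dfwith z.1 (translate g (z.1 v)),
   gp_gen e ((rho (translate g (z.1 v)))^-1 * rho (z.1 v)) * z.2).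

Let translate1 v (z : T v * G v) : translate 1 z = z.
Proof. by case: z => x g; rewrite /translate mul1g. Qed.

Lemma inverse_letter1 v z : inverse_letter (1 : G v) z = z.
Proof.
case: z => s h; rewrite /inverse_letter/= translate1 dfwith_id.
by rewrite mulVg gp_gen1 mul1g.
Qed.

Lemma inverse_letterM v (g g' : G v) z :
  inverse_letter (g * g') z = inverse_letter g (inverse_letter g' z).
Proof.
case: z => s h; rewrite /inverse_letter/= eqtype.dfwith_in dfwith_dfwith.
have -> : translate g (translate g' (s v)) = translate (g * g') (s v).
  by rewrite /translate/= mulgA.
by rewrite mulgA -gp_genM mulgA mulgK.
Qed.

Lemma inverse_letterC v u (g : G v) (g' : G u) z : e v u ->
  inverse_letter g (inverse_letter g' z) = inverse_letter g' (inverse_letter g z).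
Proof.
move=> evu; have vu := edge_neq evu; have uv : u != v by rewrite eq_sym.
case: z => s h; rewrite /inverse_letter/= !eqtype.dfwith_out// dfwithC//.
by rewrite !mulgA (gp_genC _ _ evu).
Qed.

Local Notation inverse_act := (gp_act inverse_letter).
Let inverse_actM := gp_actM inverse_letter1 inverse_letterM inverse_letterC.
Let inverse_act_gen v (g : G v) :=
  gp_act_gen inverse_letter1 inverse_letterM inverse_letterC g.

Let base (x : X) : forall v, T v * G v := fun v => (pr v x, 1).

(** Here [g] is the value at [h] of the graph product cocycle. The second conjunct carries the
    induction: if the coordinate at [v] is [p] applied to [(pr v x', 1)], a letter [l] at [v]
    replaces [p] by [p / l], and the factor [(p / l)^-1 * p] is [l]. *)
Lemma inverse_actP h x k : all_good x ->
  let g := (coupling_act h (x, k)).2^-1 * k in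
  (inverse_act g (base x, 1)).2 = h /\
  forall v, exists p, (inverse_act g (base x, 1)).1 v =
    cocycle_act (a (v := v)) (ga (v := v)) p
      (pr v (coupling_act h (x, k)).1, 1).
Proof.
move=> gx; elim/graph_product_ind: h => [|v l h] /=.
  rewrite coupling_act1/= mulVg.
  rewrite (gp_act1 inverse_letter1 inverse_letterM inverse_letterC); split=> // v.
  by exists 1; rewrite (cocycle_act1 (ec v)).
rewrite coupling_actM coupling_act_gen.
have := coupling_act_good h (z := (x, k)) gx.
case: (coupling_act h (x, k)) => x' k' /= gx' [IH2 IH1].
rewrite invgM invgK -mulgA inverse_actM inverse_act_gen.
case: (inverse_act _ _) IH2 IH1 => s h' /= -> IH1; rewrite /inverse_letter/=.
have [p sv] := IH1 v.
have tsv : translate (ga l (pr v x')) (s v) =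
    cocycle_act (a (v := v)) (ga (v := v)) (p / l) (pr v (A l x'), 1).
  rewrite sv prA /cocycle_act /translate/= -(ec_actM (ec v)) mulgVK.
  congr (_, _); rewrite !mul1g.
  rewrite -{1}(mulgVK l p) (ec_cocycle (ec v)) invgM mulgA mulgV mul1g.
  by [].
split.
  rewrite tsv sv !rhoM/=; [|exact: gx'|exact: letter_all_good].
  by rewrite !rho1 ?mulg1 ?invgM ?invgK -?mulgA ?mulVg ?mulg1//; exact: letter_all_good.
move=> u; have [<-|vu] := eqVneq v u.
  by exists (p / l); rewrite eqtype.dfwith_in.
have [q su] := IH1 u; exists q.
by rewrite eqtype.dfwith_out// su prA_out.
Qed.

(** A letter at a vertex contributes a letter at the same vertex. This shape is what
    [coupling_act_separated] uses about an [h] whose cocycle value is a product of three letters. *)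
Lemma inverse_act_three v u (m g : G v) (b : G u) x :
  exists p q p', (inverse_act (gp_gen e m * gp_gen e b * gp_gen e g) (base x, 1)).2
    = gp_gen e (p' : H v) * gp_gen e (q : H u) * gp_gen e (p : H v).
Proof.
rewrite !inverse_actM !inverse_act_gen /inverse_letter/= mulg1.
by do 3!eexists; rewrite !mulgA.
Qed.

End InverseCocycle.

Lemma exists_sections : exists rho : forall v, T v * G v -> H v,
  (forall v x, D v x -> rho v (x, 1) = 1) /\
  (forall v l z, D v z.1 ->
    rho v (cocycle_act (a (v := v)) (ga (v := v)) l z) = l * rho v z).
Proof.
exists (fun v => sval (cid (cocycle_section (ec v)))).
by split=> v; case: (cid (cocycle_section (ec v))) => rho /= [].
Qed.

Lemma coupling_act_free h x k : all_good x ->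
  (coupling_act h (x, k)).2 = k -> h = 1.
Proof.
move=> gx hk; have [rho [rho1 rhoM]] := exists_sections.
have := (inverse_actP rho1 rhoM h k gx).1; rewrite hk mulVg.
by rewrite (gp_act1 (inverse_letter1 rho) (inverse_letterM rho)
  (inverse_letterC rho)).
Qed.

(** The inverse cocycle shows that [h] is a product of letters at [v], [u], [v]. Its cocycle value
    is then such a product too, with last letter a value of [ga] at [pr v x], hence different from
    [g], and [gp_gen_separated] applies. The prefix [m] will be [1] for comparing a point over [w g]
    with one over [1], and [g^-1] for comparing points over [w g] and [w' g]. *)
Lemma coupling_act_separated v u (g m : G v) (b : G u) h x k :
  u != v -> ~~ e v u -> all_good x -> (forall l, ga l (pr v x) <> g) ->
  (coupling_act h (x, k)).2^-1 * k = gp_gen e m * gp_gen e b * gp_gen e g ->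
  b = 1.
Proof.
move=> uv evu gx xg hk; have [rho [rho1 rhoM]] := exists_sections.
have := (inverse_actP rho1 rhoM h k gx).1; rewrite hk.
have [p [q [p' ->]]] := inverse_act_three rho m g b x.
move=> hE; move: hk; rewrite -hE 2!coupling_actM !coupling_act_gen /letter_act/=.
rewrite !invgM !invgK -!mulgA mulVg mulg1.
set a' := ga p' _; set b' := ga q _.
move=> /(congr1 (fun w => w * gp_gen e g^-1)).
rewrite -!mulgA -!gp_genM mulgV gp_gen1 mulg1 => /esym.
rewrite (mulgA (gp_gen e a')).
apply: gp_gen_separated => //.
by apply/eqP => /divg1_eq; exact: xg.
Qed.

(** The action multiplies [k] on the right, so its letters are cancelled from the right end. Each
    cancellation moves [x], which therefore stays general in the induction. *)
Lemma coupling_act_onto x k :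
  (forall v y, D v y -> forall g, exists l, ga (l : H v) y = g) ->
  all_good x -> exists h, (coupling_act h (x, k)).2 = 1.
Proof.
move=> onto; elim/graph_product_rind: k x => [|v g k IHk] x gx.
  by exists 1; rewrite coupling_act1.
have [l lg] := onto v _ (gx v) g.
have [h hk] := IHk _ (letter_all_good l gx).
exists (h * gp_gen e l); rewrite coupling_actM coupling_act_gen /letter_act/= lg.
by rewrite mulgK.
Qed.

End GraphProductCocycle.

(** * Products of Polish spaces and of standard Borel spaces *)

Section ProductMetric.
Context {R : realType} (P Q : metricType R).
Implicit Types x y : P * Q.

Let dist x y : R := Num.max (mdist x.1 y.1) (mdist x.2 y.2).

Let dist_ge0 x y : (0 <= dist x y)%R.
Proof. by rewrite le_max mdist_ge0. Qed.

Let dist_positivity x y : dist x y = 0%R -> x = y.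
Proof.
case: x y => [p q] [p' q'] d0.
have /andP[dp dq] : (mdist p p' <= 0)%R && (mdist q q' <= 0)%R.
  by rewrite -ge_max; move: d0; rewrite /dist/= => ->.
congr (_, _); apply: mdist_positivity; apply/le_anti;
  by rewrite ?dp ?dq mdist_ge0.
Qed.

Let ballEdist x d : ball x d = [set y | (dist x y < d)%R].
Proof.
apply/seteqP; split=> [y [xy1 xy2]|y].
  by move: xy1 xy2; rewrite !ballEmdist/= gt_max => -> ->.
by rewrite /= gt_max => /andP[xy1 xy2]; split; rewrite ballEmdist.
Qed.

HB.instance Definition _ := PseudoMetric_isMetric.Build R (P * Q)%type
  dist_ge0 dist_positivity ballEdist.

End ProductMetric.

Section PolishSpaces.
Variable R : realType.

Lemma polish_realType : polish (R^o : metricType R).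
Proof.
split; last first.
  exists (range ratr); last exact: dense_rat.
  exact: (sub_countable (card_image_le _ _) (countableP _)).
by move=> F PF /cauchy_cvg /cvg_ex.
Qed.

Lemma polish_dense_seq (P : metricType R) : polish P -> P ->
  exists u : nat -> P, dense (range u).
Proof.
move=> [_ [D /countable_injP[f injf] dD]] p0.
exists (fun n => xget p0 [set x | D x /\ f x = n]) => O O0 oO.
have [x [Ox Dx]] := dD O O0 oO; exists x; split=> //; exists (f x) => //.
have xP : [set y | D y /\ f y = f x] x by [].
have [Dy fy] := xgetPex p0 (ex_intro [set y | D y /\ f y = f x] x xP).
by apply: injf => //; rewrite inE.
Qed.

Lemma polish_prod (P Q : metricType R) :
  polish P -> polish Q -> polish (P * Q : metricType R)%type.
Proof.
move=> [cP [D cD dD]] [cQ [E cE dE]]; split.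
  move=> F PF /cauchyP cF.
  have cF1 : cauchy (fst @ F).
    apply/cauchyP => eps eps0; have [x Fx] := cF _ eps0; exists x.1.
    suff : F (fst @^-1` ball x.1 eps) by [].
    by apply: filterS Fx => y [].
  have cF2 : cauchy (snd @ F).
    apply/cauchyP => eps eps0; have [x Fx] := cF _ eps0; exists x.2.
    suff : F (snd @^-1` ball x.2 eps) by [].
    by apply: filterS Fx => y [].
  have [l1 Fl1] := cP _ (fmap_proper_filter _ _) cF1.
  have [l2 Fl2] := cQ _ (fmap_proper_filter _ _) cF2.
  exists (l1, l2); have := cvg_pair Fl1 Fl2.
  have -> : (fun x : P * Q => (x.1, x.2)) = id by apply/funext => -[].
  exact.
exists (D `*` E); first exact: countableX.
move=> O [[x y] Oxy]; rewrite openE => /(_ _ Oxy)[[A B] /= [nA nB] ABO].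
have [x' [Ax' Dx']] : A° `&` D !=set0.
  by apply: dD; [exists x; exact: nbhs_singleton (nbhs_interior nA)|exact: open_interior].
have [y' [By' Ey']] : B° `&` E !=set0.
  by apply: dE; [exists y; exact: nbhs_singleton (nbhs_interior nB)|exact: open_interior].
exists (x', y'); split=> //.
by apply: ABO; split; exact: interior_subset.
Qed.

(** The rectangles come from balls of radius [1/(k+1)] around dense points; triples are coded by
    [pickle], and a rectangle not contained in [O] is replaced by an empty one. Countability of the
    union makes preimages of open sets measurable for the product sigma-algebra. *)
Lemma open_prod_bigcup (P Q : metricType R) (u : nat -> P) (v : nat -> Q)
    (O : set (P * Q)) : dense (range u) -> dense (range v) -> open O ->
  exists (A : nat -> set P) (B : nat -> set Q),
    [/\ forall n, open (A n), forall n, open (B n) &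
        O = \bigcup_n (A n `*` B n)].
Proof.
move=> du dv oO.
pose rad k : R := (k.+1%:R^-1)%R.
pose A i k := (ball (u i) (rad k))°; pose B j k := (ball (v j) (rad k))°.
pose ok (t : nat * nat * nat) := A t.1.1 t.2 `*` B t.1.2 t.2 `<=` O.
pose A' n := if (unpickle n : option (nat * nat * nat)) is Some t then
  if `[< ok t >] then A t.1.1 t.2 else set0 else set0.
pose B' n := if (unpickle n : option (nat * nat * nat)) is Some t then B t.1.2 t.2 else set0.
have o0 (T : topologicalType) : open (@set0 T) by exact: open0.
exists A', B'; split.
- by move=> n; rewrite /A'; case: unpickle => // t; case: ifP => // _; exact: open_interior.
- by move=> n; rewrite /B'; case: unpickle => // t; exact: open_interior.
apply/seteqP; split=> [[x y] Oxy|[x y] [n _]]; last first.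
  rewrite /A' /B'; case: unpickle => [t|[]//]; case: asboolP => [okt|_ []//].
  exact: okt.
move: oO; rewrite openE => /(_ _ Oxy) /nbhs_ballP[eps /= eps0 epsO].
(* Two radii are needed: from the given point to the centre, and from the centre to any other point
   of the ball. *)
have [k keps] : exists k, (rad k + rad k < eps)%R.
  have := near_infty_natSinv_lt (PosNum (divr_gt0 eps0 (ltr0n R 2))).
  move=> [k _ /(_ k (leqnn k)) /=]; rewrite -/(rad k) => radk; exists k.
  by rewrite [ltRHS](splitr eps) ltrD.
have k0 : (0 < rad k)%R by rewrite invr_gt0 ltr0n.
have pick (M : metricType R) (w : nat -> M) (a : M) : dense (range w) ->
    exists i, (ball (w i) (rad k))° a.
  move=> dw.
  have na : nbhs a (ball a (rad k / 2)) by apply: nbhsx_ballx; exact: divr_gt0.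
  have [b [/interior_subset awi [i _ wi]]] :
      (ball a (rad k / 2))° `&` range w !=set0.
    by apply: dw; [exists a; exact: nbhs_singleton (nbhs_interior na)|exact: open_interior].
  exists i; apply: filterS na => b' ab'; rewrite wi.
  by rewrite (splitr (rad k)); exact: ball_triangle (ball_sym awi) ab'.
have [i ui] := pick _ u x du; have [j vj] := pick _ v y dv.
exists (pickle (i, j, k)) => //; rewrite /A' /B' pickleK.
have okijk : ok (i, j, k).
  move=> [x' y'] /= [/interior_subset ux' /interior_subset vy']; apply: epsO.
  split; apply: (le_ball (ltW keps)).
    by apply: ball_triangle ux'; apply: ball_sym; exact: interior_subset ui.
  by apply: ball_triangle vy'; apply: ball_sym; exact: interior_subset vj.
by rewrite asboolT.
Qed.

End PolishSpaces.

(** Images under an injection turn complements into complements relative to the range, whence the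
    hypothesis that the range lies in [G]. *)
Lemma sigma_algebra_injective_image (T P : Type) (f : T -> P) (G : set (set P)) :
  injective f -> sigma_algebra setT G -> G (range f) ->
  sigma_algebra setT [set A | G (f @` A)].
Proof.
move=> injf [G0 GC GU] GT; split=> [|A GA|F GF] /=.
- by rewrite image_set0.
- rewrite setTD (_ : f @` (~` A) = setT `\` (f @` A `|` (setT `\` range f))).
    apply: (GC); rewrite -bigcup2E; apply: (GU) => -[|[|n]] /=.
    + exact: GA.
    + exact: GC GT.
    + exact: G0.
  apply/seteqP; split=> [_ [x Ax <-]|y [_ /not_orP[nAy]]].
    split=> // -[[x' Ax' /injf xx']|[_]]; first by apply: Ax; rewrite -xx'.
    by apply; exists x.
  rewrite setTD /setC/= => /contrapT[x _ xy]; exists x => // Ax; apply: nAy.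
  by exists x.
- by rewrite image_bigcup; exact: GU.
Qed.

Section StandardBorelProducts.
Variable R : realType.

(** That images of measurable sets are Borel is checked on rectangles. Conversely [A] is the
    preimage of its image under [h], and measurability of preimages reduces to open sets, which are
    countable unions of open rectangles. *)
Lemma standard_borel_prod d1 d2 (T1 : measurableType d1)
    (T2 : measurableType d2) : standard_borel R T1 -> standard_borel R T2 ->
  standard_borel R (T1 * T2)%type.
Proof.
move=> [P [f [pP injf fE]]] [Q [g [pQ injg gE]]].
pose h (z : T1 * T2) : P * Q := (f z.1, g z.2).
have injh : injective h by move=> [x y] [x' y'] [/injf -> /injg ->].
have [u du] := polish_dense_seq pP (f point).
have [v dv] := polish_dense_seq pQ (g point).
have sPQ : sigma_algebra setT (<<s open >> : set (set (P * Q))).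
  exact: smallest_sigma_algebra.
have rect A B : measurable A -> measurable B ->
    (<<s open >> : set (set (P * Q))) (h @` (A `*` B)).
  have pre (M : metricType R) (k : P * Q -> M) (C : set M) : continuous k ->
      <<s open >> C -> (<<s open >> : set (set (P * Q))) (k @^-1` C).
    move=> ck sC; suff : (<<s open >> : set (set M)) `<=` [set C | <<s open >> (k @^-1` C)].
      exact.
    apply: smallest_sub; last first.
      by move=> U oU; apply: sub_sigma_algebra; exact: open_comp.
    have := @sigma_algebra_image _ _ setT k _ sPQ.
    by rewrite /image_set_system; under eq_set do rewrite setTI.
  move=> /fE fA /gE gB.
  rewrite (_ : h @` _ = fst @^-1` (f @` A) `&` snd @^-1` (g @` B)).
    have [s0 sC sU] := sPQ.
    rewrite -[X in <<s open >> X]setCK setCI -bigcup2E -setTD; apply: (sC).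
    apply: (sU) => -[|[|n]] //=; rewrite -setTD; apply: (sC); apply: (pre) => //.
      by move=> z; exact: cvg_fst.
    by move=> z; exact: cvg_snd.
  apply/seteqP; split=> [_ [z [Az Bz] <-]|[p q] [[x Ax /= xp] [y By /= yq]]].
    by split; [exists z.1|exists z.2].
  by exists (x, y); rewrite // /h xp yq.
exists (P * Q)%type, h; split=> [||A]; [exact: polish_prod pP pQ|exact: injh|split].
  rewrite measurable_prod_measurableType => sA.
  suff : <<s [set A `*` B | A in measurable & B in measurable] >> `<=`
      [set A | (<<s open >> : set (set (P * Q))) (h @` A)] by exact.
  apply: smallest_sub; last by move=> _ [C mC [D mD <-]]; exact: rect.
  apply: sigma_algebra_injective_image => //.
  by have := rect _ _ measurableT measurableT; rewrite setXTT.
move=> sA; rewrite -(_ : h @^-1` (h @` A) = A); last first.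
  by apply/seteqP; split=> [z [z' Az' /injh <-]//|z Az]; exists z.
suff : (<<s open >> : set (set (P * Q))) `<=` [set A | measurable (h @^-1` A)].
  exact.
apply: smallest_sub.
  have := @sigma_algebra_image _ _ setT h _ (@sigma_algebra_measurable _ _).
  by rewrite /image_set_system; under eq_set do rewrite setTI.
move=> O oO /=; have [A' [B' [oA oB ->]]] := open_prod_bigcup du dv oO.
rewrite preimage_bigcup; apply: bigcupT_measurable => n.
have pre d (T : measurableType d) (M : metricType R) (k : T -> M) (C : set M) :
    injective k -> (forall A : set T, measurable A <-> <<s open >> (k @` A)) ->
    open C -> measurable (k @^-1` C).
  move=> injk kE oC; apply/kE.
  have [s0 sC sU] : sigma_algebra setT (<<s open >> : set (set M)).
    exact: smallest_sigma_algebra.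
  (* The image of the preimage is the trace of [C] on the range of [k], and this range is Borel. *)
  rewrite (_ : _ @` _ = setT `\` ((setT `\` range k) `|` (setT `\` C))).
    apply: (sC); rewrite -bigcup2E; apply: (sU) => -[|[|m]] //=; apply: (sC).
      by apply/kE; exact: measurableT.
    exact: sub_sigma_algebra.
  rewrite !setTD setCU !setCK.
  by apply/seteqP; split=> [_ [x Cx <-]|_ [[x _ <-] Cx]]; [split|exists x].
rewrite (_ : _ @^-1` _ = (f @^-1` A' n) `*` (g @^-1` B' n)) //.
apply: measurableX; first exact: (pre _ _ _ _ _ injf fE (oA n)).
exact: (pre _ _ _ _ _ injg gE (oB n)).
Qed.

Lemma standard_borel_discrete d (T : measurableType d) :
  countable [set: T] -> (forall A : set T, measurable A) -> standard_borel R T.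
Proof.
move=> cT mT; have /countable_injP[k injk] := cT.
exists (R^o : metricType R), (fun x => (k x)%:R : R^o); split=> [||A].
- exact: polish_realType.
- move=> x y /eqP; rewrite eqr_nat => /eqP; apply: injk; exact: in_setT.
split=> // _.
have cA : countable ((fun x => (k x)%:R : R^o) @` A).
  by apply: sub_countable (card_image_le _ _) _; exact: sub_countable (subset_card_le _) cT.
have [s0 sC sU] : sigma_algebra setT (<<s open >> : set (set R^o)).
  exact: smallest_sigma_algebra.
rewrite (_ : _ @` A = \bigcup_n [set y | ((fun x => (k x)%:R : R^o) @` A) y /\ y = n%:R]).
  apply: (sU) => n; case: (pselect (((fun x => (k x)%:R : R^o) @` A) n%:R)) => [An|nAn].
    rewrite (_ : [set _ | _] = setT `\` (~` [set n%:R])).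
      apply: (sC); apply: sub_sigma_algebra; apply: closed_openC.
      exact: (@accessible_closed_set1 R^o (@hausdorff_accessible R^o (@metric_hausdorff R R^o))).
    apply/seteqP; split=> [y [_ ->]|y [_ /contrapT ->]]; last by split.
    by split=> //; apply.
  by rewrite (_ : [set _ | _] = set0)//; apply/seteqP; split=> // y [+ yn]; rewrite yn.
by apply/seteqP; split=> [_ [x Ax <-]|y [n _ []//]]; exists (k x) => //; split=> //; exists x.
Qed.

End StandardBorelProducts.

(** * Product probabilities and measure preserving maps *)

Section ProductProbability.
Context d1 d2 (T1 : measurableType d1) (T2 : measurableType d2) (R : realType).
Variables (P1 : probability T1 R) (P2 : probability T2 R).

Definition product_probability : set (T1 * T2) -> \bar R := (P1 \x P2)%E.

HB.instance Definition _ := Measure.on product_probability.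

Let product_probability_setT : product_probability setT = 1%E.
Proof.
rewrite -setXTT /product_probability product_measure1E//.
by rewrite [X in (X * _)%E]probability_setT [X in (_ * X)%E]probability_setT mule1.
Qed.

HB.instance Definition _ := Measure_isProbability.Build _ _ _
  product_probability product_probability_setT.

Lemma product_probabilityX A B : measurable A -> measurable B ->
  product_probability (A `*` B) = (P1 A * P2 B)%E.
Proof. exact: product_measure1E. Qed.

End ProductProbability.

Definition preserves d (T : measurableType d) (R : realType)
    (mu : set T -> \bar R) (f : T -> T) : Prop :=
  measurable_fun setT f /\ forall A, measurable A -> mu (f @^-1` A) = mu A.

Lemma product_probability_preserves d1 d2 (T1 : measurableType d1)
    (T2 : measurableType d2) (R : realType) (P1 : probability T1 R)
    (P2 : probability T2 R) (f : T1 -> T1) (g : T2 -> T2) :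
  preserves P1 f -> preserves P2 g ->
  preserves (product_probability P1 P2) (fun z => (f z.1, g z.2)).
Proof.
move=> [mf fP] [mg gP].
have mfg : measurable_fun setT (fun z : T1 * T2 => (f z.1, g z.2)).
  apply: measurable_fun_pair.
    exact: measurableT_comp mf measurable_fst.
  exact: measurableT_comp mg measurable_snd.
split=> // A mA; apply/esym.
apply: (@product_measure_unique _ _ _ _ _ P1 P2
  (pushforward (product_probability P1 P2) (fun z => (f z.1, g z.2)))) => //= B C mB mC.
rewrite /pushforward (_ : _ @^-1` (B `*` C) = (f @^-1` B) `*` (g @^-1` C))//.
rewrite product_probabilityX ?fP ?gP//.
  by rewrite -[X in measurable X]setTI; exact: mf.
by rewrite -[X in measurable X]setTI; exact: mg.
Qed.

(* The last clause makes the product functorial for measure preserving maps;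
   with the joint injectivity of the projections it transports group actions. *)
Lemma finite_product_probability (R : realType) (I : eqType)
    (d : I -> measure_display) (T : forall i, measurableType (d i))
    (P : forall i, probability (T i) R) (s : seq I) :
  (forall i, standard_borel R (T i)) -> uniq s ->
  exists (d' : measure_display) (X : measurableType d') (Q : probability X R)
    (pr : forall i, X -> T i),
  [/\ standard_borel R X,
      forall i, measurable_fun setT (pr i),
      forall i, i \in s -> forall A, measurable A -> Q (pr i @^-1` A) = P i A,
      forall x y, (forall i, i \in s -> pr i x = pr i y) -> x = y &
      forall F : forall i, T i -> T i, (forall i, preserves (P i) (F i)) ->
        exists2 f : X -> X, preserves Q f &
          forall i, i \in s -> forall x, pr i (f x) = F i (pr i x)].
Proof.
move=> sb; elim: s => [_|i s IHs /= /andP[i_notin uniq_s]].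
  (* The empty product is a point. Indices outside the list keep the constant [point], so the
     clauses on values of [pr] are restricted to [i \in s]. *)
  exists _, unit, (dirac tt : probability unit R), (fun i _ => point); split=> //.
  - apply: standard_borel_discrete => // ; exact: countableP.
  - by move=> x y _; case: x; case: y.
  - by move=> F _; exists id => //; split.
have [d' [X [Q [pr [sbX mpr Qpr inj_pr fun_pr]]]]] := IHs uniq_s.
pose pr' j (z : T i * X) : T j := eqtype.dfwith (fun j => pr j z.2) z.1 j.
have pr'i z : pr' i z = z.1 by exact: eqtype.dfwith_in.
have pr'j j z : i != j -> pr' j z = pr j z.2 by move=> ij; exact: eqtype.dfwith_out.
have s_neq j : j \in s -> i != j by apply: contraTneq => <-.
exists _, (T i * X)%type, (product_probability (P i) Q), pr'; split.
- exact: standard_borel_prod.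
- move=> j; have [<-|ij] := eqVneq i j.
    by apply: eq_measurable_fun measurable_fst => z _; rewrite pr'i.
  apply: (eq_measurable_fun (pr j \o snd)) => [z _|]; first by rewrite pr'j.
  exact: measurableT_comp (mpr j) measurable_snd.
- move=> j; rewrite inE => /predU1P[->|js] A mA.
    rewrite (_ : _ @^-1` A = A `*` setT); last first.
      by apply/seteqP; split=> z; rewrite /= pr'i// => -[].
    by rewrite [LHS]product_probabilityX// [X in (_ * X)%E]probability_setT mule1.
  rewrite (_ : _ @^-1` A = setT `*` (pr j @^-1` A)); last first.
    by apply/seteqP; split=> z; rewrite /= pr'j ?s_neq// => -[].
  rewrite [LHS]product_probabilityX//; last first.
    by rewrite -[X in measurable X]setTI; exact: mpr.
  by rewrite [X in (X * _)%E]probability_setT mul1e Qpr.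
- move=> [t x] [t' x'] prE; congr (_, _).
    by have := prE i; rewrite !pr'i inE eqxx; exact.
  apply: inj_pr => j js; have := prE j.
  by rewrite !pr'j ?s_neq// inE js orbT; exact.
- move=> F Fm; have [f fm prf] := fun_pr F Fm.
  exists (fun z => (F i z.1, f z.2)).
    exact: product_probability_preserves.
  move=> j; rewrite inE => /predU1P[->|js] z; first by rewrite !pr'i.
  by rewrite !pr'j ?s_neq// prf.
Qed.

(** * Countable groups and countable decompositions *)

Section Countability.

Lemma countable_surj (U : Type) (u0 : U) : countable [set: U] ->
  exists s : nat -> U, forall u, exists n, s n = u.
Proof.
move=> /countable_injP[k injk].
pose s n := if pselect (exists u, k u = n) is left ex then sval (cid ex) else u0.
exists s => u; exists (k u); rewrite /s; case: pselect => [ex|[]]; last by exists u.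
by case: cid => v /= kv; apply: injk => //; exact: in_setT.
Qed.

Lemma surj_countable (U : Type) (C : countType) (s : C -> U) :
  (forall u, exists n, s n = u) -> countable [set: U].
Proof.
move=> surj; rewrite (_ : [set: U] = range s).
  exact: sub_countable (card_image_le _ _) (countableP _).
by apply/seteqP; split=> // u _; have [n <-] := surj u; exists n.
Qed.

Lemma countable_fg (G : groupType) : finitely_generated G -> countable [set: G].
Proof.
move=> [s sgen].
pose letter (p : bool * nat) : G := if p.1 then s`_p.2 else (s`_p.2)^-1.
pose eval (w : seq (bool * nat)) := foldr (fun p x => letter p * x) 1 w.
have evalM w w' : eval (w ++ w') = eval w * eval w'.
  by elim: w => [|p w IHw] /=; rewrite ?mul1g// IHw mulgA.
have evalV w : exists w', eval w' = (eval w)^-1.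
  elim: w => [|p w [w' IHw]] /=; first by exists [::]; rewrite invg1.
  exists (w' ++ [:: (~~ p.1, p.2)]); rewrite evalM IHw invgM /= mulg1; congr (_ * _).
  by rewrite /letter/=; case: p.1; rewrite /= ?invgK.
pose S : {pred G} := [pred x | `[< exists w, eval w = x >]].
have SP x : reflect (exists w, eval w = x) (x \in S) by exact: asboolP.
apply: (@surj_countable _ _ eval) => x; apply/SP; apply: (sgen S) => [|y ys].
  split=> [|_ _ /SP[w <-] /SP[w' <-]]; first by apply/SP; exists [::].
  by apply/SP; have [w'' <-] := evalV w'; exists (w ++ w'').
apply/SP; exists [:: (true, index y s)].
by rewrite /= mulg1 /letter/= nth_index.
Qed.

Lemma countable_graph_product (V : finType) (e : rel V) (A : V -> groupType) :
  (forall v, countable [set: A v]) -> countable [set: graph_product e A].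
Proof.
move=> cA; pose s v := sval (cid (countable_surj (1 : A v) (cA v))).
have sP v u : exists n, s v n = u by rewrite /s; case: cid => s' /=; exact.
pose eval (w : seq (V * nat)) : graph_product e A :=
  foldr (fun p x => gp_gen e (s p.1 p.2) * x) 1 w.
apply: (@surj_countable _ _ eval) => x.
elim/graph_product_ind: x => [|v a x [w wx]]; first by exists [::].
by have [n <-] := sP v a; exists ((v, n) :: w); rewrite /= wx.
Qed.

Lemma countable_setX (U U' : Type) : countable [set: U] -> countable [set: U'] ->
  countable [set: (U * U')%type].
Proof. by move=> cU cU'; rewrite -setXTT; exact: countableX. Qed.

Context d (T : measurableType d) (R : realType) (mu : {measure set T -> \bar R}).

Lemma negligible_bigcup_countable (U : Type) (F : U -> set T) :
  countable [set: U] -> (forall u, mu.-negligible (F u)) ->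
  mu.-negligible (\bigcup_u F u).
Proof.
move=> cU F0; have [[u0]|U0] := pselect (inhabited U); last first.
  rewrite (_ : \bigcup_u F u = set0); first exact: negligible_set0.
  by apply/seteqP; split=> // x [u]; case: U0.
have [s sP] := countable_surj u0 cU.
apply: negligibleS (negligible_bigcup (fun n => F0 (s n))) => x [u _ Fx].
by have [n sn] := sP u; exists n; rewrite ?sn.
Qed.

Lemma bigcap_measurable_countable (U : Type) (F : U -> set T) :
  countable [set: U] -> (forall u, measurable (F u)) -> measurable (\bigcap_u F u).
Proof.
move=> cU mF; rewrite -[X in measurable X]setCK setC_bigcap; apply: measurableC.
by apply: countable_bigcupT_measurable => // u; exact: measurableC.
Qed.

End Countability.

(** Tool for piecewise defined maps: invariance of measure is checked on countably many pieces. The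
    pieces are renumbered by naturals through [k], with empty pieces at the numbers that [k]
    misses. *)
Lemma measure_bigcup_countable_eq d (T : measurableType d) d' (T' : measurableType d')
    (R : realType) (mu : {measure set T -> \bar R}) (mu' : {measure set T' -> \bar R})
    (U : Type) (F : U -> set T) (F' : U -> set T') : countable [set: U] ->
  (forall u, measurable (F u)) -> (forall u, measurable (F' u)) ->
  trivIset setT F -> trivIset setT F' ->
  (forall u, mu (F u) = mu' (F' u)) -> mu (\bigcup_u F u) = mu' (\bigcup_u F' u).
Proof.
move=> /countable_injP[k injk] mF mF' tF tF' FF'.
have kinj u v : k u = k v -> u = v by apply: injk; exact: in_setT.
pose E (Z : Type) (H : U -> set Z) n : set Z := \bigcup_(u in [set u | k u = n]) H u.
have Ek (Z : Type) (H : U -> set Z) u : E Z H (k u) = H u.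
  by apply/seteqP; split=> [z [v /= /kinj ->]//|z Hz]; exists u.
have E0 (Z : Type) (H : U -> set Z) n : (forall u, k u <> n) -> E Z H n = set0.
  by move=> kn; apply/seteqP; split=> // z [u /= /kn].
have EU (Z : Type) (H : U -> set Z) : \bigcup_u H u = \bigcup_n E Z H n.
  apply/seteqP; split=> [z [u _ Hz]|z [n _ [u _ Hz]]]; last by exists u.
  by exists (k u) => //; exists u.
have kP n : (exists u, k u = n) \/ (forall u, k u <> n).
  by have [?|/forallNP] := pselect (exists u, k u = n); [left|right].
have mE (d1 : measure_display) (Z : measurableType d1) (H : U -> set Z) n :
    (forall u, measurable (H u)) -> measurable (E Z H n).
  by move=> mH; have [[u <-]|kn] := kP n; [rewrite Ek|rewrite E0].
have tE (Z : Type) (H : U -> set Z) : trivIset setT H -> trivIset setT (E Z H).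
  move=> tH i j _ _ [z [[u /= <- Hu] [v /= <- Hv]]].
  by congr k; apply: tH => //; exists z.
rewrite !EU !measure_bigcup//;
  [|by move=> n _; exact: mE|exact: tE|by move=> n _; exact: mE|exact: tE].
apply: eq_eseriesr => n _.
by have [[u <-]|kn] := kP n; [rewrite !Ek|rewrite !E0// !measure0].
Qed.

(** * From couplings to embedding cocycles *)

Section CouplingToCocycle.
Variables (R : realType) (d : measure_display) (T : measurableType d).
Variable mu : {measure set T -> \bar R}.

(** Countability of [K] gathers all exceptions into one null set: the uncovered points and, for each
    [g] other than [1], the overlap of [Z] with its translate by [g^-1]. *)
Lemma fundamental_domain_exact (K : groupType) (act : K -> T -> T) (Z : set T) :
  countable [set: K] -> (forall x, act 1 x = x) ->
  (forall g h x, act (g * h) x = act g (act h x)) ->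
  fundamental_domain mu act Z ->
  exists N, mu.-negligible N /\ forall x, ~ N x ->
    (exists g, Z (act g x)) /\ forall g, Z x -> Z (act g x) -> g = 1.
Proof.
move=> cK act1 actM [_ cover disj].
have actVK g x : act g^-1 (act g x) = x by rewrite -actM mulVg act1.
have actKV g x : act g (act g^-1 x) = x by rewrite -actM mulgV act1.
pose F g := if g == 1 then set0 else (act 1 @` Z `&` act g^-1 @` Z) `+` set0.
exists ((setT `+` \bigcup_g (act g @` Z)) `|` \bigcup_g F g); split.
  apply: negligibleU => //; apply: negligible_bigcup_countable => // g; rewrite /F.
  have [_|g1] := eqVneq g 1; first exact: negligible_set0.
  by apply: disj; rewrite eq_sym invg_eq1.
move=> x /not_orP[ncov nF]; split.
  apply: contrapT => nex; apply: ncov; left; split=> // -[g _ [z Zz zx]].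
  by apply: nex; exists g^-1; rewrite -zx actVK.
move=> g Zx Zgx; apply/eqP; apply: contrapT => /negP g1; apply: nF.
exists g => //; rewrite /F (negPf g1); left; split; last by [].
by split; [exists x|exists (act g x)].
Qed.

Variables (L G : groupType) (act : (L * G)%type -> T -> T).
Hypotheses (cL : countable [set: L]) (cG : countable [set: G]).
Hypothesis actP : mp_action mu act.

Let act1 x : act 1 x = x. Proof. by case: actP. Qed.
Let actM p q x : act (p * q) x = act p (act q x). Proof. by case: actP. Qed.
Let act_meas p A : measurable A -> measurable (act p @^-1` A).
Proof.
by case: actP => _ _ mact _ mA; rewrite -[X in measurable X]setTI; exact: mact.
Qed.
Let act_mu p A : measurable A -> mu (act p @^-1` A) = mu A.
Proof. by case: actP => _ _ _; apply. Qed.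
Let actVK p x : act p^-1 (act p x) = x.
Proof. by rewrite -actM mulVg act1. Qed.

(** The exceptional set is saturated under [L * G]; it stays null as a countable union of preimages
    under measure preserving maps, and whole orbits avoid it. [E] leaves room for one more null set,
    the excess of [Y] over [X] at index 1. *)
Lemma coupling_exact (Y X E : set T) :
  fundamental_domain mu (fun l => act (l, 1)) Y ->
  fundamental_domain mu (fun g => act (1, g)) X ->
  ae_subset mu X Y -> mu.-negligible E ->
  exists N, [/\ measurable N, mu N = 0%E, E `<=` N &
      forall p x, N (act p x) -> N x] /\
    forall x, ~ N x ->
    [/\ exists g, X (act (1, g) x),
        forall g, X x -> X (act (1, g) x) -> g = 1,
        exists l, Y (act (l, 1) x),
        forall l, Y x -> Y (act (l, 1) x) -> l = 1 &
        X x -> Y x].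
Proof.
move=> fY fX XY E0.
have [||NY [NY0 NYP]] := fundamental_domain_exact cL _ _ fY.
- exact: act1.
- by move=> g h x; rewrite -actM; congr act; congr (_, _); rewrite mulg1.
have [||NX [NX0 NXP]] := fundamental_domain_exact cG _ _ fX.
- exact: act1.
- by move=> g h x; rewrite -actM; congr act; congr (_, _); rewrite mulg1.
have [M [mM M0 NM]] : mu.-negligible (NY `|` NX `|` (X `\` Y) `|` E).
  by do !apply: negligibleU => //.
exists (\bigcup_p act p @^-1` M); split; last first.
  move=> x nx; have {}nx : ~ (NY `|` NX `|` (X `\` Y) `|` E) x.
    by move=> /NM Mx; apply: nx; exists 1; rewrite //= act1.
  have /NYP[Yx Yx'] : ~ NY x by move=> ?; apply: nx; do !left.
  have /NXP[Xx Xx'] : ~ NX x by move=> ?; apply: nx; do 2!left; right.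
  split=> // Xxx; apply: contrapT => nYx; apply: nx; left; right; split=> //.
have cLG : countable [set: (L * G)%type] by exact: countable_setX.
have mN : measurable (\bigcup_p act p @^-1` M).
  by apply: countable_bigcupT_measurable => // p; exact: act_meas.
split=> //.
- apply/negligibleP => //; apply: negligible_bigcup_countable => // p.
  exists (act p @^-1` M); split=> //; first exact: act_meas.
  by rewrite act_mu.
- by move=> x Ex; exists 1; rewrite //= act1; apply: NM; right.
- by move=> p x [q _ Mqp]; exists (q * p); rewrite //= actM.
Qed.

End CouplingToCocycle.

(** The probability stays on all of [T] and is concentrated on [D], which is [X] without the
    invariant null set; [T] is thus the standard Borel space already at hand. For [x] in [D],
    [ga l x] is the unique [g] such that [(l, g)] brings [x] back to [D]. *)
Lemma coupling_embedding_cocycle (R : realType) (L G : groupType) (c : \bar R)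
    (d : measure_display) (T : measurableType d) (mu : {measure set T -> \bar R})
    (act : (L * G)%type -> T -> T) (Y X : set T) :
  countable [set: L] -> countable [set: G] ->
  mu setT = +oo%E -> mp_action mu act ->
  fundamental_domain mu (fun l => act (l, 1)) Y ->
  fundamental_domain mu (fun g => act (1, g)) X ->
  (mu X < +oo)%E -> ae_subset mu X Y -> c = (mu Y / mu X)%E ->
  exists (P : probability T R) (a : L -> T -> T) (ga : L -> T -> G) (D : set T),
  [/\ measurable D, P D = 1%E, embedding_cocycle a ga D &
      forall l, preserves P (a l)] /\
  [/\ forall l g, measurable [set x | ga l x = g],
      infinite_set [set: G],
      c = 1%E -> forall x, D x -> forall g, exists l, ga l x = g &
      c <> 1%E -> exists g, P [set x | D x /\ forall l, ga l x <> g] <> 0%E].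
Proof.
move=> cL cG muT actP fY fX Xoo XY cE.
have [mY _ _] := fY; have [mX _ _] := fX.
have act1 x : act 1 x = x by case: actP.
have actM p q x : act (p * q) x = act p (act q x) by case: actP.
have act_meas p A : measurable A -> measurable (act p @^-1` A).
  by case: actP => _ _ mact _ mA; rewrite -[X in measurable X]setTI; exact: mact.
have act_mu p A : measurable A -> mu (act p @^-1` A) = mu A.
  by case: actP => _ _ _; apply.
have actVK p x : act p^-1 (act p x) = x by rewrite -actM mulVg act1.
have actVK2 l g x : act (l^-1, g^-1) (act (l, g) x) = x by exact: (actVK (l, g)).
have key E := coupling_exact cL cG actP fY fX XY (E := E).
have muX0 : mu X <> 0%E.
  move=> X0; have [N [[mN N0 _ _] NP]] := key set0 (negligible_set0 _).
  suff : mu setT = 0%E by rewrite muT.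
  apply: measure_negligible => //.
  apply: (@negligibleS _ _ _ _ (N `|` \bigcup_g act (1, g) @^-1` X)).
    move=> x _; have [?|/NP[[g Xg] _ _ _ _]] := pselect (N x); first by left.
    by right; exists g.
  apply: negligibleU; first exact/negligibleP.
  apply: negligible_bigcup_countable => // g; exists (act (1, g) @^-1` X).
  by split=> //; [exact: act_meas|rewrite act_mu].
have muX0' : mu X != 0%E by exact/eqP.
have finX : mu X \is a fin_num by rewrite ge0_fin_numE.
have YXE : mu Y = (mu (Y `\` X) + mu X)%E.
  rewrite (measureDI mu mY mX) setIC [in RHS](measureDI mu mX mY).
  by rewrite [X in (_ + (X + _))%E](measure_negligible _ XY) ?add0e//; exact: measurableD.
have c1E : c = 1%E -> mu.-negligible (Y `\` X).
  move=> c1; apply/negligibleP; first exact: measurableD.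
  suff YX : mu Y = mu X.
    by move: YXE; rewrite YX => /(congr1 (fun z => z - mu X)%E); rewrite addeK// subee.
  by rewrite -[LHS]mule1 -(divee finX muX0') [(mu X / _)%E]muleC muleA -cE c1 mul1e.
(* At index 1 the excess of [Y] over [X] is null; placing it in the exceptional set gives
   surjectivity at every point of [D]. *)
have [E [E0 EP]] : exists E, mu.-negligible E /\ (c = 1%E -> Y `\` X `<=` E).
  have [c1|c1] := pselect (c = 1%E); first by exists (Y `\` X); split; [exact: c1E|move=> _ ?].
  by exists set0; split=> //; exact: negligible_set0.
have [N [[mN N0 EN Ninv] NP]] := key E E0.
have Ninv' p x : ~ N x -> ~ N (act p x) by move=> nNx /Ninv.
pose D := X `\` N; have mD : measurable D by exact: measurableD.
have muD : mu D = mu X.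
  rewrite (measureDI mu mX mN) [X in (_ + X)%E](_ : _ = 0%E) ?adde0//.
  by apply/eqP; rewrite -measure_le0 -N0 measureIr.
have exD l x : ~ N x -> exists g, D (act (l, g) x).
  move=> /(Ninv' (l, 1)) nNx; have [[g Xg] _ _ _ _] := NP _ nNx.
  exists g; rewrite /D -[X in act X](_ : (1, g) * (l, 1) = (l, g)); last first.
    by congr (_, _); rewrite ?mul1g ?mulg1.
  by rewrite actM; split=> //; exact: Ninv'.
have uniqD l g g' x : D (act (l, g) x) -> D (act (l, g') x) -> g = g'.
  move=> [Xg nNg] [Xg' _]; have [_ Xuniq _ _ _] := NP _ nNg.
  apply/esym/divg1_eq; apply: Xuniq => //; rewrite -actM.
  rewrite (_ : _ * _ = (l, g'))//; congr (_, _); first exact: mul1g.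
  exact: mulgVK.
pose ga l x : G := if pselect (D x) then xget 1 [set g | D (act (l, g) x)] else 1.
have gaP l x : D x -> D (act (l, ga l x) x).
  move=> Dx; rewrite /ga; case: pselect => [?|//].
  have [g Dg] := exD l x Dx.2.
  exact: (xgetPex 1 (ex_intro [set g | D (act (l, g) x)] g Dg)).
have ga_uniq l g x : D x -> D (act (l, g) x) -> ga l x = g.
  by move=> /(gaP l) Dga; exact: uniqD.
have ga_out l x : ~ D x -> ga l x = 1 by rewrite /ga; case: pselect.
pose a l x : T := if pselect (D x) then act (l, ga l x) x else x.
have aE l x : D x -> a l x = act (l, ga l x) x by rewrite /a; case: pselect.
have a_out l x : ~ D x -> a l x = x by rewrite /a; case: pselect.
have aD l x : D x -> D (a l x) by move=> Dx; rewrite aE//; exact: gaP.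
have ga1 x : ga 1 x = 1.
  have [Dx|] := pselect (D x); last exact: ga_out.
  by apply: ga_uniq => //; rewrite act1.
have gaM l l' x : ga (l * l') x = ga l (a l' x) * ga l' x.
  have [Dx|nDx] := pselect (D x); last by rewrite !ga_out// ?mulg1 ?a_out// ga_out.
  apply: ga_uniq => //; rewrite -[X in act X]/((l, ga l (a l' x)) * (l', ga l' x)).
  rewrite actM -(aE l' x Dx) -(aE l _ (aD l' x Dx)); exact: (aD _ _ (aD _ _ Dx)).
have ecP : embedding_cocycle a ga D.
  split=> // [x|l l' x|l x Dx ga_1].
  - have [Dx|] := pselect (D x); last exact: a_out.
    by rewrite aE// ga1 act1.
  - have [Dx|nDx] := pselect (D x); last by rewrite !a_out.
    by rewrite (aE (l * l'))// gaM (aE l) ?aE// -?actM//; rewrite -aE//; exact: aD.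
  have := gaP l x Dx; rewrite ga_1 => -[Xl nNl].
  have [Xx nNx] := Dx; have [_ _ _ Yuniq XYx] := NP _ nNx.
  have [_ _ _ _ XYl] := NP _ nNl.
  by apply: Yuniq; [exact: XYx|exact: XYl].
have mga l g : measurable [set x | ga l x = g].
  rewrite (_ : [set _ | _] = (D `&` act (l, g) @^-1` D) `|` (if g == 1 then ~` D else set0)).
    apply: measurableU; first by apply: measurableI => //; exact: act_meas.
    by case: ifP => // _; exact: measurableC.
  apply/seteqP; split=> x /=.
    have [Dx gax|nDx] := pselect (D x); first by left; split=> //; rewrite /= -gax; exact: gaP.
    by rewrite ga_out// => <-; right; rewrite eqxx.
  move=> [[Dx]|]; first exact: ga_uniq.
  by case: eqP => // -> nDx; exact: ga_out.
(* On each level set of [ga l] within [D], [a l] is the action of one group element. *)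
have a_pre l A : (a l @^-1` A) `&` D = \bigcup_g (D `&` act (l, g) @^-1` (D `&` A)).
  apply/seteqP; split=> [x [Aax Dx]|x [g _ [Dx [Dg Ag]]]].
    by exists (ga l x) => //; split=> //; rewrite /= -aE//; split=> //; exact: aD.
  by split=> //=; rewrite aE// (ga_uniq l g).
have mapre l A : measurable A -> measurable ((a l @^-1` A) `&` D).
  move=> mA; rewrite a_pre; apply: countable_bigcupT_measurable => // g.
  by apply: measurableI => //; apply: act_meas; exact: measurableI.
have ma l : measurable_fun setT (a l).
  move=> _ A mA; rewrite setTI -(setIT (_ @^-1` _)) -(setUv D) setIUr.
  apply: measurableU; first exact: mapre.
  rewrite (_ : _ `&` _ = A `&` ~` D); first by apply: measurableI => //; exact: measurableC.
  by apply/seteqP; split=> x [Ax nDx]; split=> //; move: Ax; rewrite /= a_out.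
(* Both sides are cut according to [g]: the part of [D] that [(l, g)] sends into [D] and [A]
   corresponds to the part of [D] and [A] that [(l^-1, g^-1)] sends back into [D]. *)
have muaD l A : measurable A -> mu ((a l @^-1` A) `&` D) = mu (A `&` D).
  move=> mA; have mDA : measurable (D `&` A) by exact: measurableI.
  rewrite a_pre (_ : A `&` D = \bigcup_g (D `&` A `&` act (l^-1, g^-1) @^-1` D)); last first.
    apply/seteqP; split=> [x [Ax Dx]|x [g _ [[Dx Ax] _]]//].
    have [g Dg] := exD l^-1 x Dx.2; exists g^-1 => //; split=> //.
    by rewrite /= invgK.
  apply: measure_bigcup_countable_eq => //.
  - by move=> g; apply: measurableI => //; exact: act_meas.
  - by move=> g; apply: measurableI => //; exact: act_meas.
  - by move=> g g' _ _ [x [[_ [Dg _]] [_ [Dg' _]]]]; exact: uniqD Dg Dg'.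
  - move=> g g' _ _ [x [[_ Dg] [_ Dg']]]; apply: invg_inj.
    exact: uniqD Dg Dg'.
  - move=> g; rewrite -(act_mu (l, g) (D `&` A `&` act (l^-1, g^-1) @^-1` D)); last first.
      by apply: measurableI => //; exact: act_meas.
    congr (mu _); apply/seteqP; split=> [x [Dx [Dg Ag]]|x [[Dg Ag] /= ]].
      by split; [split|rewrite /= actVK2].
    by rewrite actVK2.
(* [dirac point] is the fallback of [mnormalize] for mass zero or infinity, excluded by [muX0] and
   [Xoo]. *)
pose P : probability T R := mnormalize (mrestr mu mD) (dirac point).
have PE A : P A = (mu (A `&` D) * (fine (mu X))^-1%:E)%E.
  rewrite /P /= /mnormalize /= /mrestr setTI muD.
  by rewrite ifF//; apply/negbTE; rewrite negb_or; apply/andP; split; [exact/eqP|rewrite lt_eqF].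
have fX0 : fine (mu X) != 0%R by rewrite fine_eq0//; exact/eqP.
exists P, a, ga, D; split; split=> //.
- by rewrite PE setIid muD -{1}(fineK finX) -EFinM divff.
- by move=> l; split=> // A mA; rewrite !PE muaD.
- move=> finG; have : (mu setT < +oo)%E; last by rewrite muT.
  rewrite (measureDI mu measurableT mN) [X in (_ + mu X)%E]setTI N0 adde0.
  rewrite (_ : _ `\` _ = \bigcup_(g in setT) act (1, g) @^-1` D); last first.
    apply/seteqP; split=> [x [_ nNx]|x [g _ [_ nN]]].
      by have [g Dg] := exD 1 x nNx; exists g.
    by split=> // Nx; apply: nN; rewrite -[x](actVK (1, g)) in Nx; exact: Ninv Nx.
  rewrite measure_fin_bigcup//; last 2 first.
  - by move=> g g' _ _ [x [Dg Dg']]; exact: uniqD Dg Dg'.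
  - by move=> g _; exact: act_meas.
  by rewrite fsbig_finite//; apply: lte_sum_pinfty => g _ /=; rewrite act_mu// muD.
(* Moving [x] by [g] and then into [Y] by some [l] lands in [X], because the rest of [Y] lies in
   [N]. *)
- move=> c1 x Dx g; have [_ nN] := Dx.
  have [_ _ [l Yl] _ _] := NP _ (Ninv' (1, g) _ nN).
  exists l; apply: ga_uniq => //; move: Yl; rewrite -actM.
  rewrite (_ : _ * _ = (l, g)); last by congr (_, _); rewrite ?mul1g ?mulg1.
  move=> Yl; have nNl := Ninv' (l, g) _ nN; split=> //.
  by apply: contrapT => nX; apply: nNl; apply: EN; apply: EP.
- move=> c1; apply: contrapT => /forallNP PB; apply: c1.
  pose B g := [set x | D x /\ forall l, ga l x <> g].
  have mB g : measurable (B g).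
    rewrite (_ : B g = D `&` \bigcap_l (~` [set x | ga l x = g])).
      apply: measurableI => //; apply: bigcap_measurable_countable => // l.
      exact: measurableC.
    by apply/seteqP; split=> x [Dx Bx]; split=> // l; [move=> _|]; exact: Bx.
  have B0 g : mu (B g) = 0%E.
    have /contrapT := PB g; rewrite PE => /eqP; rewrite mule_eq0 => /orP[/eqP|].
      rewrite (_ : _ `&` D = B g)//; apply/seteqP; split=> x; first by case.
      by move=> Bx; split=> //; case: Bx.
    by rewrite eqe invr_eq0 (negPf fX0).
  (* A point [y] of [Y] outside [X] and [N] is moved by some [g] to a point of [D] whose cocycle
     misses [g^-1]: the value [g^-1] at [l] would put the image of [y] under [(l, 1)] into [X],
     hence into [Y], forcing [l = 1] and [y] in [X]. *)
  have YX0 : mu (Y `\` X) = 0%E.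
    apply: measure_negligible; first exact: measurableD.
    apply: (@negligibleS _ _ _ _ (N `|` \bigcup_g act (1, g) @^-1` B g^-1)).
      move=> y [Yy nXy]; have [?|nNy] := pselect (N y); [by left|right].
      have [g Dg] := exD 1 y nNy; exists g => //; split=> // l gal.
      have := gaP l _ Dg; rewrite gal -actM.
      rewrite (_ : _ * _ = (l, 1)); last by congr (_, _); rewrite ?mulg1 ?mulVg.
      move=> [Xl nNl]; have [_ _ _ Yuniq _] := NP _ nNy.
      have [_ _ _ _ XYl] := NP _ nNl.
      have l1 := Yuniq l Yy (XYl Xl); move: Xl; rewrite l1 act1; exact: nXy.
    apply: negligibleU; first exact/negligibleP.
    apply: negligible_bigcup_countable => // g.
    exists (act (1, g) @^-1` B g^-1); split=> //; first exact: act_meas.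
    by rewrite act_mu.
  by rewrite cE YXE YX0 add0e divee//; exact/eqP.
Qed.

Lemma SMI_embedding_cocycle (R : realType) (L G : groupType) (c : \bar R) :
  countable [set: L] -> countable [set: G] -> SMI L G c ->
  exists (d : measure_display) (T : measurableType d) (P : probability T R)
    (a : L -> T -> T) (ga : L -> T -> G) (D : set T),
  standard_borel R T /\
  [/\ measurable D, P D = 1%E, embedding_cocycle a ga D &
      forall l, preserves P (a l)] /\
  [/\ forall l g, measurable [set x | ga l x = g],
      infinite_set [set: G],
      c = 1%E -> forall x, D x -> forall g, exists l, ga l x = g &
      c <> 1%E -> exists g, P [set x | D x /\ forall l, ga l x <> g] <> 0%E].
Proof.
move=> cL cG [d [T [mu [act [Y [X [[sbT muT actP] [fY fX Xoo XY cE]]]]]]]].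
have [P [a [ga [D [P1 P2]]]]] :=
  coupling_embedding_cocycle cL cG muT actP fY fX Xoo XY cE.
by exists d, T, P, a, ga, D.
Qed.

(** * Measure preserving skew products with a countable group *)

Definition discrete (G : groupType) : Type := G.

Section DiscreteGroup.
Variable G : groupType.

HB.instance Definition _ := Choice.on (discrete G).
HB.instance Definition _ := isPointed.Build (discrete G) (1 : G).
HB.instance Definition _ := @isMeasurable.Build default_measure_display
  (discrete G) discrete_measurable discrete_measurable0
  discrete_measurableC discrete_measurableU.

End DiscreteGroup.

Section CountingProduct.
Context (R : realType) (d : measure_display) (T : measurableType d).
Variables (P : probability T R) (G : groupType).
Hypothesis cG : countable [set: G].

Let count : set (discrete G) -> \bar R := @counting (discrete G) R.

HB.instance Definition _ := Measure.on count.

Let count1 k : count [set k] = 1%E.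
Proof.
rewrite /count /counting asboolT; last exact: finite_set1.
by rewrite fset_set1 finmap.cardfs1.
Qed.

Let count_sigma_finite : sigma_finite setT count.
Proof.
have [s sP] := countable_surj (1 : G) cG.
exists (fun n => [set s n : discrete G]).
  by apply/seteqP; split=> // g _; have [n <-] := sP g; exists n.
by move=> n; split=> //; rewrite count1 ltry.
Qed.

HB.instance Definition _ := Measure_isSigmaFinite.Build _ _ _ count
  count_sigma_finite.

Let prod_count : set (T * discrete G) -> \bar R := (P \x count)%E.

HB.instance Definition _ := Measure.on prod_count.

Let prod_count_slice B k : measurable B -> prod_count (B `*` [set k]) = P B.
Proof.
move=> mB; transitivity (P B * count [set k])%E; first exact: product_measure1E.
by rewrite count1 mule1.
Qed.

Let prod_count_sigma_finite : sigma_finite setT prod_count.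
Proof.
have [s sP] := countable_surj (1 : G) cG.
exists (fun n => setT `*` [set s n : discrete G]).
  by apply/seteqP; split=> // -[x g] _; have [n <-] := sP g; exists n.
move=> n; split; first exact: measurableX.
by rewrite prod_count_slice// probability_setT ltry.
Qed.

HB.instance Definition _ := Measure_isSigmaFinite.Build _ _ _ prod_count
  prod_count_sigma_finite.

Lemma exists_counting_product :
  exists nu : {sigma_finite_measure set (T * discrete G)%type -> \bar R},
    (forall B k, measurable B -> nu (B `*` [set k]) = P B) /\
    (forall B (K : set G), measurable B -> infinite_set K -> P B <> 0%E ->
      nu (B `*` (K : set (discrete G))) = +oo%E).
Proof.
exists prod_count; split=> [B k|B K mB infK PB]; first exact: prod_count_slice.
transitivity (P B * count K)%E; first exact: product_measure1E.
have -> : count K = +oo%E by rewrite /count /counting asboolF.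
by rewrite muleC gt0_mulye// lt0e measure_ge0 andbT; exact/eqP.
Qed.

End CountingProduct.

Section FreeActions.
Context (R : realType) (d : measure_display) (T : measurableType d).
Variables (P : probability T R) (G : groupType).
Hypotheses (cG : countable [set: G]) (infG : infinite_set [set: G]).
Variable nu : {measure set (T * discrete G)%type -> \bar R}.
Hypothesis nu_slice : forall B k, measurable B -> nu (B `*` [set k]) = P B.

Let section (A : set (T * discrete G)) (k : G) : set T := [set x | A (x, k)].

Lemma measurable_section (A : set (T * discrete G)) k : measurable A -> measurable (section A k).
Proof.
move=> mA; rewrite (_ : section A k = ysection A k); first exact: measurable_ysection.
by apply/seteqP; split=> x /=; rewrite /ysection/= inE.
Qed.

Lemma measurable_slice (B : set T) (k : discrete G) : measurable B -> measurable (B `*` [set k]).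
Proof. by move=> mB; exact: measurableX. Qed.

Lemma preserves_comp (mu : {measure set (T * discrete G)%type -> \bar R}) f g :
  preserves mu f -> preserves mu g -> preserves mu (f \o g).
Proof.
move=> [mf fP] [mg gP]; split; first exact: measurableT_comp.
move=> A mA; rewrite comp_preimage gP ?fP//.
by rewrite -[X in measurable X]setTI; exact: mf.
Qed.

Lemma preserves_mull (g : G) :
  preserves nu (fun z => (z.1, g * z.2) : T * discrete G).
Proof.
have preE A : (fun z => (z.1, g * z.2) : T * discrete G) @^-1` A =
    \bigcup_k (section A (g * k) `*` [set (k : discrete G)]).
  apply/seteqP; split=> [[x k] Axk|[x k] [k' _ [Axk /= ->]]//]; by exists k.
have mF A k : measurable A -> measurable (section A (g * k) `*` [set (k : discrete G)]).
  by move=> mA; apply: measurable_slice; exact: measurable_section.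
split=> [_ A mA|A mA].
  by rewrite setTI preE; apply: countable_bigcupT_measurable => // k; exact: mF.
rewrite preE [in RHS](_ : A =
    \bigcup_k (section A (g * k) `*` [set (g * k : discrete G)])); last first.
  apply/seteqP; split=> [[x k] Axk|[x k] [k' _ [Axk /= ->]]//].
  by exists (g^-1 * k) => //; split; rewrite /section /= mulVKg.
apply: measure_bigcup_countable_eq => //.
- by move=> k; exact: mF.
- by move=> k; apply: measurable_slice; exact: measurable_section.
- by move=> k k' _ _ [z [[_ /= <-] [_ /= ->]]].
- by move=> k k' _ _ [z [[_ /= ->] [_ /= /mulgI]]].
- by move=> k; rewrite !nu_slice//; exact: measurable_section.
Qed.

(** With the value [g] of [k0] and the second coordinate [k] fixed, the map sends the slice over [k]
    to the slice over [k / g] and acts there as [f]; slices carry the measure [P]. On the target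
    side [k0] is read through [finv]. *)
Lemma preserves_cocycle (f finv : T -> T) (k0 : T -> G) :
  cancel f finv -> cancel finv f -> preserves P f -> measurable_fun setT finv ->
  (forall g, measurable [set x | k0 x = g]) ->
  preserves nu (fun z => (f z.1, z.2 * (k0 z.1)^-1) : T * discrete G).
Proof.
move=> fK finvK [mf fP] mfinv mk0; set phi := (X in preserves nu X).
have mpre (h : T -> T) (A : set T) : measurable_fun [set: T] h ->
    measurable A -> measurable (h @^-1` A).
  by move=> mh mA; rewrite -[X in measurable X]setTI; exact: mh.
pose F A (p : G * G) : set (T * discrete G) :=
  ([set x | k0 x = p.1] `&` f @^-1` section A (p.2 / p.1)) `*` [set p.2].
pose F' A (p : G * G) : set (T * discrete G) :=
  ([set x | k0 (finv x) = p.1] `&` section A (p.2 / p.1)) `*` [set p.2 / p.1].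
have preE A : phi @^-1` A = \bigcup_p F A p.
  apply/seteqP; split=> [[x k] Axk|[x k] [[g k'] _ [[/= k0x Afx] /= ->]]].
    by exists (k0 x, k).
  by rewrite /phi/= k0x.
have AE A : A = \bigcup_p F' A p.
  apply/seteqP; split=> [[x k] Axk|[x k] [[g k'] _ [[_ Ax] /= ->]]//].
  by exists (k0 (finv x), k * k0 (finv x)) => //; rewrite /F'/= /section/= mulgK.
have mF A p : measurable A -> measurable (F A p).
  move=> mA; apply: measurable_slice; apply: measurableI => //.
  by apply: mpre => //; exact: measurable_section.
have mk0' g : measurable [set x | k0 (finv x) = g] by exact: (mpre finv _ mfinv (mk0 g)).
have cGG : countable [set: (G * G)%type] by exact: countable_setX.
split=> [_ A mA|A mA].
  by rewrite setTI preE; apply: countable_bigcupT_measurable => // p; exact: mF.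
rewrite preE [in RHS](AE A); apply: measure_bigcup_countable_eq => //.
- by move=> p; exact: mF.
- move=> p; apply: measurable_slice; apply: measurableI => //.
  exact: measurable_section.
- move=> [g k] [g' k'] _ _ [[x j] [[[/= <- _] /= ->] [[/= <- _] /= ->]]].
  by [].
- move=> [g k] [g' k'] _ _ [[x j] [[[/= <- _] /= ->] [[/= <- _] /= ]]].
  by move=> /mulIg ->.
- move=> [g k]; rewrite !nu_slice/=.
  + rewrite -[RHS]fP; last by apply: measurableI => //; exact: measurable_section.
    by congr (P _); apply/seteqP; split=> x /=; rewrite fK.
  + by apply: measurableI => //; exact: measurable_section.
  + by apply: measurableI => //; apply: mpre => //; exact: measurable_section.
Qed.

End FreeActions.

(** * From free actions to couplings *)

Section FreeActionToCoupling.
Context (R : realType) (d : measure_display) (T : measurableType d).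
Variables (P : probability T R) (L G : groupType).
Hypothesis sbT : standard_borel R T.
Hypotheses (cL : countable [set: L]) (cG : countable [set: G]).
Hypothesis infG : infinite_set [set: G].
Variable nu : {sigma_finite_measure set (T * discrete G)%type -> \bar R}.
Hypothesis nu_slice : forall B k, measurable B -> nu (B `*` [set k]) = P B.
Hypothesis nu_oo : forall B (K : set G), measurable B -> infinite_set K ->
  P B <> 0%E -> nu (B `*` (K : set (discrete G))) = +oo%E.
Variable psi : L -> T * discrete G -> T * discrete G.
Hypothesis psi1 : forall z, psi 1 z = z.
Hypothesis psiM : forall l l' z, psi (l * l') z = psi l (psi l' z).
Hypothesis psi_mull : forall l x (k k' : G),
  psi l (x, k' * k) = ((psi l (x, k)).1, (k' * (psi l (x, k)).2 : G)).
Hypothesis psiP : forall l, preserves nu (psi l).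
Variable D : set T.
Hypotheses (mD : measurable D) (PD : P D = 1%E).
Hypothesis psiD : forall l z, D z.1 -> D (psi l z).1.
Hypothesis psi_free : forall l x k, D x -> (psi l (x, k)).2 = k -> l = 1.

Let psiVK l z : psi l^-1 (psi l z) = z. Proof. by rewrite -psiM mulVg. Qed.

Lemma negligible_bad : nu.-negligible [set z : T * discrete G | ~ D z.1].
Proof.
rewrite (_ : [set _ | _] = \bigcup_k ((~` D) `*` [set (k : discrete G)])).
  apply: negligible_bigcup_countable => // k.
  have mDC : measurable (~` D) by exact: measurableC.
  exists ((~` D) `*` [set k]); split=> //; first exact: measurable_slice.
  by rewrite [LHS]nu_slice// probability_setC// PD subee.
by apply/seteqP; split=> [[x k] nDx|[x k] [k' _ []]//]; exists k.
Qed.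

(* [Y] collects the points minimizing, over their orbit, a rank that is [0]
   exactly on [Z] and otherwise enumerates [G]. *)
Lemma SMI_free_action (Z : set (T * discrete G)) : measurable Z ->
  (forall x, Z (x, (1 : G))) ->
  (forall l z, D z.1 -> Z z -> Z (psi l z) -> l = 1) ->
  exists Y, [/\ measurable Y, Z `<=` Y,
    forall z, Y z -> (exists l, Z (psi l z)) -> Z z &
    SMI L G (nu Y)].
Proof.
move=> mZ Z1 Zsep; have /countable_injP[k injk] := cG.
pose r z := if pselect (Z z) then 0%N else (k z.2).+1.
have r0 z : Z z -> r z = 0%N by rewrite /r; case: pselect.
have r0P z : r z = 0%N -> Z z by rewrite /r; case: pselect.
have rS z : ~ Z z -> r z = (k z.2).+1 by rewrite /r; case: pselect.
have mr n : measurable [set z | r z = n].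
  case: n => [|n].
    by rewrite (_ : [set _ | _] = Z)//; apply/seteqP; split=> z; [exact: r0P|exact: r0].
  rewrite (_ : [set _ | _] = (~` Z) `&` snd @^-1` [set g : discrete G | k g = n]).
    apply: measurableI; first exact: measurableC.
    by rewrite -[X in measurable X]setTI; exact: (@measurable_snd _ _ T (discrete G)).
  apply/seteqP; split=> z /=; rewrite /r.
    by case: (pselect (Z z)) => // nZ [<-].
  by case: (pselect (Z z)) => [Zz [/(_ Zz)]//|nZ [_ ->]].
pose Y := [set z | forall l, (r z <= r (psi l z))%N].
have mY : measurable Y.
  rewrite (_ : Y = \bigcap_l \bigcap_n \bigcap_m
      ~` ([set z | r z = n /\ (m < n)%N] `&` psi l @^-1` [set z | r z = m])).
    apply: bigcap_measurable_countable => // l.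
    apply: bigcap_measurable_countable => // n.
    apply: bigcap_measurable_countable => // m; apply: measurableC.
    apply: measurableI.
      case: (ltnP m n) => mn.
        by rewrite (_ : [set _ | _] = [set z | r z = n])//; apply/seteqP; split=> z //= [].
      by rewrite (_ : [set _ | _] = set0)//; apply/seteqP; split=> z //= [].
    by have [mpsi _] := psiP l; rewrite -[X in measurable X]setTI; exact: mpsi.
  apply/seteqP; split=> [z Yz l _ n _ m _ [[<- mr'] /= rm]|z Yz l].
    by have := Yz l; rewrite leqNgt rm mr'.
  rewrite leqNgt; apply/negP => rl.
  by apply: (Yz l I (r z) I (r (psi l z)) I).
have ZY : Z `<=` Y by move=> z Zz l; rewrite r0.
exists Y; split=> // [z Yz [l Zl]|].
  by apply: r0P; have := Yz l; rewrite (r0 _ Zl) leqn0 => /eqP.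
pose act (p : L * G) (z : T * discrete G) : T * discrete G :=
  ((psi p.1 z).1, (p.2 * (psi p.1 z).2 : G)).
pose X : set (T * discrete G) := setT `*` [set (1 : G)].
have actl l z : act (l, 1) z = psi l z by rewrite /act/= mul1g -surjective_pairing.
have actg g z : act (1, g) z = (z.1, g * z.2) by rewrite /act/= psi1.
have ZX : X `<=` Z by move=> [x g] [_ /= ->]; exact: Z1.
have muX : nu X = 1%E by rewrite [LHS]nu_slice// probability_setT.
exists _, (T * discrete G)%type, nu, act, Y, X; split.
  split.
  - apply: standard_borel_prod => //; exact: standard_borel_discrete.
  - by rewrite -setXTT [LHS]nu_oo// probability_setT; exact/eqP/onee_neq0.
  split=> [z|[l g] [l' g'] z|[l g]|[l g] A mA].
  - by rewrite (actl 1) psi1.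
  - rewrite /act/= psiM; case: (psi l' z) => x k'/=.
    by rewrite psi_mull/= mulgA.
  - have := preserves_comp (preserves_mull cG nu_slice g) (psiP l).
    by case.
  have [_] := preserves_comp (preserves_mull cG nu_slice g) (psiP l).
  exact.
split=> //.
- split=> //; last first.
    (* Two points of [Y] in one orbit have equal rank. Rank [0] puts both in [Z], where [Zsep]
       applies; a positive rank determines the second coordinate, and [psi_free] applies. *)
    move=> l l' ll'; apply: negligibleS negligible_bad => z.
    move=> [[[[y Yy <-] [y' Yy' yy']] _] Dz|[]//].
    apply/negP: ll'; rewrite negbK; move: yy' Dz; rewrite !actl => yy' Dz.
    have y'E : y' = psi (l'^-1 * l) y by rewrite psiM -yy' psiVK.
    have Dy : D y.1 by rewrite -(psiVK l y); exact: psiD.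
    suff : l'^-1 * l = 1 by move=> /mulg1_eq; rewrite invgK => ->.
    have ry : r (psi (l'^-1 * l) y) = r y.
      apply/eqP; rewrite eqn_leq; apply/andP; split; last exact: Yy.
      have := Yy' (l'^-1 * l)^-1; rewrite y'E psiVK; exact.
    have [Zy|nZy] := pselect (Z y).
      by apply: (Zsep _ y) => //; apply: r0P; rewrite ry; exact: r0.
    have nZy' : ~ Z (psi (l'^-1 * l) y) by move=> /r0; rewrite ry => /r0P.
    move: ry; rewrite !rS// => -[/injk]; rewrite !in_setT => /(_ isT isT).
    by case: y Dy {Yy yy' Dz y'E nZy nZy'} => x g Dx; exact: psi_free.
  apply: negligibleS (negligible_set0 nu) => z [[_ ncov]|[_ []]//].
  apply: ncov.
  have [m [l lm] minm] : exists2 m, exists l, r (psi l z) = m & forall l, (m <= r (psi l z))%N.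
    have exm : exists m, `[< exists l, r (psi l z) = m >].
      by exists (r (psi 1 z)); apply/asboolP; exists 1.
    case: (ex_minnP exm) => m /asboolP exl minm; exists m => // l.
    by apply: minm; apply/asboolP; exists l.
  exists l^-1 => //; exists (psi l z); last by rewrite actl psiVK.
  by move=> l'; rewrite lm -psiM.
- split.
  + exact: measurable_slice.
  + apply: negligibleS (negligible_set0 nu) => z [[_ ncov]|[_ []]//].
    apply: ncov; exists (z.2 : G) => //; exists (z.1, (1 : G)) => //.
    by rewrite actg/= mulg1 -surjective_pairing.
  + move=> g g' gg'; apply: negligibleS (negligible_set0 nu) => z.
    move=> [[[[[x1 k1] [_ /= ->] <-] [[x2 k2] [_ /= ->]]] + _]|[]//].
    by rewrite !actg/= !mulg1 => -[_ gE]; rewrite gE eqxx in gg'.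
- by rewrite muX ltry.
- by apply: negligibleS (negligible_set0 nu) => z [/ZX/ZY].
- by rewrite muX /inve oner_eq0 invr1 mule1.
Qed.

End FreeActionToCoupling.

(** * The coupling between the graph products *)

Section GraphProductCoupling.
Variables (R : realType) (V : finType) (e : rel V) (H G : V -> groupType).
Hypotheses (e_sym : symmetric e) (e_irr : irreflexive e).
Hypotheses (cH : forall v, countable [set: H v]) (cG : forall v, countable [set: G v]).
Variables (d : V -> measure_display) (T : forall v, measurableType (d v)).
Variable P : forall v, probability (T v) R.
Variables (a : forall v, H v -> T v -> T v) (ga : forall v, H v -> T v -> G v).
Variable D : forall v, set (T v).
Arguments a : clear implicits.
Arguments ga : clear implicits.
Arguments D : clear implicits.
Hypothesis sbT : forall v, standard_borel R (T v).
Hypothesis mD : forall v, measurable (D v).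
Hypothesis PD : forall v, P v (D v) = 1%E.
Hypothesis ec : forall v, embedding_cocycle (a v) (ga v) (D v).
Hypothesis aP : forall v h, preserves (P v) (a v h).
Hypothesis mga : forall v h g, measurable [set x | ga v h x = g].

Local Notation HP := (graph_product e H).
Local Notation GP := (graph_product e G).

Lemma exists_product_action : exists (d' : measure_display) (X : measurableType d')
    (Q : probability X R) (pr : forall v, X -> T v) (A : forall v, H v -> X -> X),
  [/\ standard_borel R X, forall v, measurable_fun setT (pr v),
      forall v B, measurable B -> Q (pr v @^-1` B) = P v B &
      forall v h, preserves Q (A v h)] /\
  [/\ forall v x, A v 1 x = x,
      forall v (h h' : H v) x, A v (h * h') x = A v h (A v h' x),
      forall v u (h : H v) (k : H u) x, v != u -> A v h (A u k x) = A u k (A v h x),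
      forall v h x, pr v (A v h x) = a v h (pr v x) &
      forall v u h x, v != u -> pr u (A v h x) = pr u x].
Proof.
have [d' [X [Q [pr [sbX mpr Qpr inj_pr fun_pr]]]]] :=
  finite_product_probability P sbT (enum_uniq V).
have exA v h : exists f : X -> X, [/\ preserves Q f,
    forall x, pr v (f x) = a v h (pr v x) &
    forall u x, v != u -> pr u (f x) = pr u x].
  have [|f fQ prf] := fun_pr (eqtype.dfwith (fun _ => id) (a v h)).
    by move=> u; case: eqtype.dfwithP => [|w _]; [exact: aP|split].
  exists f; split=> // [x|u x vu]; rewrite prf ?mem_enum//.
    by rewrite eqtype.dfwith_in.
  by rewrite eqtype.dfwith_out.
pose A v h := sval (cid (exA v h)).
have AQ v h : preserves Q (A v h) by rewrite /A; case: cid => f [].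
have prA v h x : pr v (A v h x) = a v h (pr v x) by rewrite /A; case: cid => f [].
have prA_out v u h x : v != u -> pr u (A v h x) = pr u x.
  by rewrite /A; case: cid => f [? ? f_out]; exact: f_out.
have eqX x y : (forall v, pr v x = pr v y) -> x = y.
  by move=> xy; apply: inj_pr => v _; exact: xy.
exists d', X, Q, pr, A; split; split=> //.
- by move=> v B mB; apply: Qpr => //; rewrite mem_enum.
- move=> v x; apply: eqX => u; have [<-|vu] := eqVneq v u.
    by rewrite prA (ec_act1 (ec v)).
  by rewrite prA_out//.
- move=> v h h' x; apply: eqX => u; have [<-|vu] := eqVneq v u.
    by rewrite !prA (ec_actM (ec v)).
  by rewrite !prA_out//.
- move=> v u h k x vu; have uv : u != v by rewrite eq_sym.
  apply: eqX => w; have [<-|vw] := eqVneq v w.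
    by rewrite prA !(prA_out _ _ k _ uv) prA.
  rewrite [LHS](prA_out _ _ h _ vw); have [<-|uw] := eqVneq u w.
    by rewrite !prA (prA_out _ _ h _ vu).
  by rewrite !(prA_out _ _ k _ uw) (prA_out _ _ h _ vw).
Qed.

(** Index 1 and infinite index share this space and action; they differ in the set [Z] given to the
    last clause. The other clauses serve to verify that [Z] is separated and to measure the
    resulting [Y]. *)
Lemma exists_coupling_act : infinite_set [set: GP] ->
  exists (d' : measure_display) (X : measurableType d') (Q : probability X R)
    (nu : {sigma_finite_measure set (X * discrete GP)%type -> \bar R})
    (pr : forall v, X -> T v) (psi : HP -> X * discrete GP -> X * discrete GP),
  [/\ forall v, measurable_fun setT (pr v),
      forall v B, measurable B -> Q (pr v @^-1` B) = P v B,
      forall B k, measurable B -> nu (B `*` [set k]) = Q B &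
      forall B (K : set GP), measurable B -> infinite_set K ->
        Q B <> 0%E -> nu (B `*` (K : set (discrete GP))) = +oo%E] /\
  [/\ forall h z, all_good D pr z.1 -> all_good D pr (psi h z).1,
      forall h z, psi h^-1 (psi h z) = z,
      forall h x k, all_good D pr x -> (psi h (x, k)).2 = k -> h = 1,
      forall v u (g m : G v) (b : G u) h x (k : GP),
        u != v -> ~~ e v u -> all_good D pr x ->
        (forall l, ga v l (pr v x) <> g) ->
        ((psi h (x, k)).2 : GP)^-1 * k = gp_gen e m * gp_gen e b * gp_gen e g ->
        b = 1 &
      forall x k,
        (forall v y, D v y -> forall g, exists l, ga v l y = g) ->
        all_good D pr x -> exists h, (psi h (x, k)).2 = 1 :> GP] /\
  nu.-negligible [set z | ~ all_good D pr z.1] /\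
  forall Z : set (X * discrete GP), measurable Z ->
  (forall x, Z (x, (1 : GP))) ->
  (forall l z, all_good D pr z.1 -> Z z -> Z (psi l z) -> l = 1) ->
  exists Y, [/\ measurable Y, Z `<=` Y,
    forall z, Y z -> (exists l, Z (psi l z)) -> Z z &
    SMI HP GP (nu Y)].
Proof.
move=> infG.
have cHP : countable [set: HP] by exact: countable_graph_product.
have cGP : countable [set: GP] by exact: countable_graph_product.
have [d' [X [Q [pr [A [[sbX mpr Qpr AQ] [A1 AM AC prA prA_out]]]]]]] := exists_product_action.
have [nu [nu_slice nu_oo]] := exists_counting_product Q cGP.
pose psi : HP -> X * discrete GP -> X * discrete GP :=
  coupling_act (T := fun v => T v) ga A pr.
have psi1 := coupling_act1 e_irr ec A1 AM AC prA prA_out.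
have psiM := coupling_actM e_irr ec A1 AM AC prA prA_out.
have psi_gen := coupling_act_gen e_irr ec A1 AM AC prA prA_out.
have psi_good := coupling_act_good e_irr ec A1 AM AC prA prA_out.
have psi_free := coupling_act_free e_irr ec A1 AM AC prA prA_out.
have psi_mull := coupling_act_mull e_irr ec A1 AM AC prA prA_out.
have psi_sep := coupling_act_separated e_sym e_irr ec A1 AM AC prA prA_out.
have psi_onto := coupling_act_onto e_irr ec A1 AM AC prA prA_out.
have psiP h : preserves nu (psi h).
  elim/graph_product_ind: h => [|v h w IHw].
    rewrite (_ : psi 1 = id); first by split.
    by apply/funext => z; exact: psi1.
  rewrite (_ : psi _ = letter_act (T := fun v => T v) ga A pr h \o psi w); last first.
    by apply/funext => z; rewrite /psi psiM psi_gen.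
  apply: preserves_comp IHw.
  apply: (preserves_cocycle cGP nu_slice (f := A v h) (finv := A v h^-1)
    (k0 := fun x => gp_gen e (ga v h (pr v x)))).
  - by move=> x; rewrite -AM mulVg A1.
  - by move=> x; rewrite -AM mulgV A1.
  - exact: AQ.
  - by case: (AQ v h^-1).
  (* Since [gp_gen] is injective, the level set is that of a single value of [ga], or empty. *)
  - move=> g; have [[b <-]|nb] := pselect (exists b : G v, gp_gen e b = g).
      rewrite (_ : [set _ | _] = pr v @^-1` [set x | ga v h x = b]).
        by rewrite -[X in measurable X]setTI; apply: mpr => //; exact: mga.
      by apply/seteqP; split=> x /=; [move/(gp_gen_inj e_sym e_irr)|move=> ->].
    rewrite (_ : [set _ | _] = set0)//; apply/seteqP; split=> // x /= xg.
    by apply: nb; eexists; exact: xg.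
pose DX := [set x | all_good D pr x].
have DXE : ~` DX = \bigcup_v (pr v @^-1` (~` D v)).
  apply/seteqP; split=> [x /existsNP[v nDx]|x [v _ nDx]]; first by exists v.
  by move=> /(_ v).
have cV : countable [set: V] by exact: countableP.
have mpre v : measurable (pr v @^-1` (~` D v)).
  by rewrite -[X in measurable X]setTI; apply: mpr => //; exact: measurableC.
have mDXC : measurable (~` DX).
  by rewrite DXE; exact: countable_bigcupT_measurable.
have mDX : measurable DX by rewrite -[DX]setCK; exact: measurableC.
have QpreC v : Q (pr v @^-1` (~` D v)) = 0%E.
  rewrite Qpr; last exact: measurableC.
  by rewrite probability_setC// PD subee.
have QDXC : Q (~` DX) = 0%E.
  apply: measure_negligible => //; rewrite DXE; apply: negligible_bigcup_countable => // v.
  by exists (pr v @^-1` (~` D v)); split=> //; exact: QpreC.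
have QDX : Q DX = 1%E by rewrite -[DX]setCK probability_setC// QDXC sube0.
exists d', X, Q, nu, pr, psi; split; first by split.
split.
  split.
  - exact: psi_good.
  - by move=> h z; rewrite /psi -psiM mulVg psi1.
  - exact: psi_free.
  - by move=> v u g m b h x k; exact: psi_sep.
  - exact: psi_onto.
have bad0 := negligible_bad cGP nu_slice mDX QDX.
split; first exact: bad0.
move=> Z mZ Z1 Zsep.
exact: (SMI_free_action sbX cHP cGP infG nu_slice nu_oo psi1 psiM _ psiP mDX QDX).
Qed.

End GraphProductCoupling.

(** * Isomorphic groups and graphs with one vertex *)

Lemma SMI_isomorphic (R : realType) (L L' G G' : groupType) (c : \bar R)
    (f : L' -> L) (g : G' -> G) :
  {morph f : x y / x * y} -> bijective f ->
  {morph g : x y / x * y} -> bijective g ->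
  SMI L G c -> SMI L' G' c.
Proof.
move=> fM fbij gM gbij [d [T [mu [act [Y [X [[sbT muT actP] [fY fX Xoo XY cE]]]]]]]].
have f1 : f 1 = 1 by apply: (@mulgI _ (f 1)); rewrite /= -fM !mulg1.
have g1 : g 1 = 1 by apply: (@mulgI _ (g 1)); rewrite /= -gM !mulg1.
have [act1 actM mact actmu] := actP.
have fd (K K' : groupType) (h : K' -> K) (b : K -> T -> T) (Z : set T) :
    bijective h -> fundamental_domain mu b Z ->
    fundamental_domain mu (fun k => b (h k)) Z.
  move=> hbij [mZ cover disj]; have hinj := bij_inj hbij.
  have [hinv hK hinvK] := hbij; split=> // [|k k' kk'].
    rewrite (_ : \bigcup_k (b (h k) @` Z) = \bigcup_k (b k @` Z))//.
    apply/seteqP; split=> x [k _ bkx]; first by exists (h k).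
    by exists (hinv k) => //; rewrite hinvK.
  by apply: disj; apply: contra kk' => /eqP /hinj ->.
exists d, T, mu, (fun p => act (f p.1, g p.2)), Y, X; split.
  split=> //; split=> [x|[l k] [l' k'] x|[l k]|[l k]].
  - by rewrite f1 g1; exact: act1.
  - by rewrite -actM; congr act; congr (_, _); [exact: fM|exact: gM].
  - exact: mact.
  - exact: actmu.
split=> //.
- rewrite (_ : (fun l => _) = fun l => act (f l, 1)); first exact: fd fbij fY.
  by apply/funext => l; rewrite /= g1.
- rewrite (_ : (fun k => _) = fun k => act (1, g k)); first exact: fd gbij fX.
  by apply/funext => k; rewrite /= f1.
Qed.

Section SingleVertex.
Variables (V : finType) (e : rel V) (A : V -> groupType) (v : V).
Hypotheses (e_irr : irreflexive e) (V1 : forall u : V, u = v).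
Local Notation GP := (graph_product e A).

Let mul_at u (a : A u) (s : forall w, A w) : forall w, A w :=
  eqtype.dfwith s (a * s u).

Let mul_at1 u s : mul_at (1 : A u) s = s.
Proof. by rewrite /mul_at mul1g dfwith_id. Qed.

Let mul_atM u (a b : A u) s : mul_at (a * b) s = mul_at a (mul_at b s).
Proof. by rewrite /mul_at eqtype.dfwith_in dfwith_dfwith mulgA. Qed.

Let mul_atC u w (a : A u) (b : A w) s : e u w ->
  mul_at a (mul_at b s) = mul_at b (mul_at a s).
Proof.
by move=> euw; exfalso; move: euw; rewrite (V1 u) (V1 w) e_irr.
Qed.

(** With one vertex there are no edges, so left multiplication of coordinates respects all
    relations. Evaluating on the trivial family gives the inverse of [gp_gen]. *)
Definition single_vertex (x : GP) : A v := gp_act mul_at x (fun=> 1) v.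

Lemma single_vertex_gen (a : A v) x : single_vertex (gp_gen e a * x) = a * single_vertex x.
Proof.
rewrite /single_vertex (gp_actM mul_at1 mul_atM mul_atC).
by rewrite (gp_act_gen mul_at1 mul_atM mul_atC) /mul_at eqtype.dfwith_in.
Qed.

Lemma single_vertex1 : single_vertex 1 = 1.
Proof. by rewrite /single_vertex (gp_act1 mul_at1 mul_atM mul_atC). Qed.

Lemma gp_gen_single_vertex x : gp_gen e (single_vertex x) = x.
Proof.
elim/graph_product_ind: x => [|u a x IHx]; first by rewrite single_vertex1 gp_gen1.
by move: a; rewrite (V1 u) => a; rewrite single_vertex_gen gp_genM IHx.
Qed.

Lemma single_vertexM : {morph single_vertex : x y / x * y}.
Proof.
by move=> x y; rewrite -{1}(gp_gen_single_vertex x) single_vertex_gen.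
Qed.

Lemma single_vertex_bij : bijective single_vertex.
Proof.
exists (fun a => gp_gen e a); first exact: gp_gen_single_vertex.
by move=> a; rewrite -[gp_gen e a]mulg1 single_vertex_gen single_vertex1 mulg1.
Qed.

End SingleVertex.

(** Otherwise the graph is the join of [v] with the remaining vertices, a nonempty set because [v]
    is not alone. *)
Lemma irreducible_nonadjacent (V : finType) (e : rel V) (v : V) :
  symmetric e -> irreducible_graph e -> #|V| != 1%N ->
  exists2 u, u != v & ~~ e v u.
Proof.
move=> e_sym irr V1; apply: contrapT => nex; apply: irr.
have adj u : u != v -> e v u.
  by move=> uv; apply: contrapT => /negP evu; apply: nex; exists u.
exists (finset.set1 v), (finset.setC (finset.set1 v)); split.
- by apply/finset.set0Pn; exists v; rewrite finset.set11.
- apply: contra V1 => /eqP V0; rewrite -(finset.cardsC (finset.set1 v)) V0.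
  by rewrite finset.cards1 finset.cards0.
- exact: finset.setICr.
- exact: finset.setUCr.
move=> x y; rewrite /join_rel !finset.inE.
have [->|xv] := eqVneq x v; have [->|yv] := eqVneq y v; rewrite /= ?andbT ?orbF//.
- exact: adj.
- by rewrite e_sym adj.
Qed.

(* One package per vertex, so that the choice over the vertices is made once. *)
Record cocycle_model (R : realType) (L G : groupType) (c : \bar R) := CocycleModel {
  cm_display : measure_display ;
  cm_space : measurableType cm_display ;
  cm_prob : probability cm_space R ;
  cm_act : L -> cm_space -> cm_space ;
  cm_cocycle : L -> cm_space -> G ;
  cm_good : set cm_space ;
  cm_borel : standard_borel R cm_space ;
  cm_good_meas : measurable cm_good ;
  cm_good1 : cm_prob cm_good = 1%E ;
  cm_ec : embedding_cocycle cm_act cm_cocycle cm_good ;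
  cm_preserves : forall l, preserves cm_prob (cm_act l) ;
  cm_cocycle_meas : forall l g, measurable [set x | cm_cocycle l x = g] ;
  cm_onto : c = 1%E -> forall x, cm_good x -> forall g, exists l, cm_cocycle l x = g ;
  cm_not_onto : c <> 1%E -> exists g,
    cm_prob [set x | cm_good x /\ forall l, cm_cocycle l x <> g] <> 0%E }.
Arguments cm_act {R L G c}.
Arguments cm_cocycle {R L G c}.
Arguments cm_good {R L G c}.

Lemma SMI_cocycle_model (R : realType) (L G : groupType) (c : \bar R) :
  countable [set: L] -> countable [set: G] -> SMI L G c ->
  infinite_set [set: G] /\ inhabited (cocycle_model L G c).
Proof.
move=> cL cG /(SMI_embedding_cocycle cL cG)[d [T [P [a [ga [D [sbT
  [[mD PD ec aP] [mga infG onto nonto]]]]]]]]].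
split=> //; constructor.
exact: (CocycleModel sbT mD PD ec aP mga onto nonto).
Qed.

(** * The two values of the index *)

Section GraphProductSMI.
Variables (R : realType) (V : finType) (e : rel V) (H G : V -> groupType).
Variable c : V -> \bar R.
Hypotheses (e_sym : symmetric e) (e_irr : irreflexive e).
Hypotheses (cH : forall v, countable [set: H v]) (cG : forall v, countable [set: G v]).
Hypothesis infG : forall v, infinite_set [set: G v].
Hypothesis V_gt0 : (0 < #|V|)%N.
Variable m : forall v, cocycle_model (H v) (G v) (c v).

Local Notation HP := (graph_product e H).
Local Notation GP := (graph_product e G).

Lemma infinite_graph_product : infinite_set [set: GP].
Proof.
have [v _] := card_gt0P V_gt0; move=> finGP; apply: (@infG v).
rewrite (_ : setT = gp_gen e (v := v) @^-1` [set: GP])//.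
by apply: finite_preimage finGP => x y _ _; exact: gp_gen_inj.
Qed.

Let model := exists_coupling_act e_sym e_irr cH cG
  (fun v => cm_borel (m v)) (fun v => cm_good_meas (m v))
  (fun v => cm_good1 (m v)) (fun v => cm_ec (m v))
  (fun v => cm_preserves (m v)) (fun v => cm_cocycle_meas (m v))
  infinite_graph_product.

(** With surjective cocycles almost every orbit meets the slice over [1], and a point of [Y] whose
    orbit meets [Z] lies in [Z]. So [Y] exceeds this slice, of mass one, by a null set. *)
Lemma graph_product_SMI1 : (forall v, c v = 1%E) -> SMI HP GP (1%E : \bar R).
Proof.
move=> c1.
have [d' [X [Q [nu [pr [psi [[mpr Qpr nu_slice nu_oo]
  [[psi_good psiVK psi_free _ psi_onto] [bad0 mkSMI]]]]]]]]] := model.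
have mZ : measurable ([set: X] `*` [set (1 : GP) : discrete GP]) by exact: measurable_slice.
have [//||Y [mY ZY YZ]] := mkSMI _ mZ.
  move=> l [x k] gx [_ /= ->] [_ /= lz].
  exact: psi_free gx lz.
suff -> : nu Y = 1%E by [].
rewrite (measureDI nu mY mZ) setIC (setIidl ZY).
rewrite [X in (_ + X)%E]nu_slice// probability_setT.
rewrite [X in (X + _)%E](measure_negligible (measurableD mY mZ)) ?add0e//.
apply: negligibleS bad0 => -[x k] [Yz nZ] gx; apply: nZ; apply: YZ => //.
have [h hk] := psi_onto x k (fun v y => cm_onto (c1 v) (x := y)) gx.
by exists h; split.
Qed.

Lemma graph_product_SMIoo v u : c v <> 1%E -> u != v -> ~~ e v u ->
  SMI HP GP (+oo%E : \bar R).
Proof.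
move=> cv uv evu.
have [d' [X [Q [nu [pr [psi [[mpr Qpr nu_slice nu_oo]
  [[psi_good psiVK psi_free psi_sep _] [bad0 mkSMI]]]]]]]]] := model.
have [g PB] := cm_not_onto (m v) cv.
pose Bv := [set x | cm_good (m v) x /\ forall l, cm_cocycle (m v) l x <> g].
have mBv : measurable Bv.
  rewrite (_ : Bv = cm_good (m v) `&` \bigcap_l (~` [set x | cm_cocycle (m v) l x = g])).
    apply: measurableI; first exact: cm_good_meas.
    apply: bigcap_measurable_countable => // l; apply: measurableC.
    exact: cm_cocycle_meas.
  by apply/seteqP; split=> x [Dx Bx]; split=> // l; [move=> _|]; exact: Bx.
pose B := pr v @^-1` Bv.
have mB : measurable B by rewrite -[X in measurable X]setTI; exact: mpr.
have QB : Q B <> 0%E by rewrite Qpr.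
pose W : set GP := [set gp_gen e w * gp_gen e g | w in [set w : G u | w <> 1]].
have infW : infinite_set W.
  move=> finW; apply: (@infG u).
  have fin1 : finite_set [set w : G u | w <> 1].
    have winj : injective (fun w : G u => gp_gen e w * gp_gen e g).
      by move=> w w' /mulIg /(gp_gen_inj e_sym e_irr).
    apply: sub_finite_set (finite_preimage (in2W winj) finW) => w w1.
    by exists w.
  rewrite (_ : setT = [set w : G u | w <> 1] `|` [set 1]).
    by rewrite finite_setU; split=> //; exact: finite_set1.
  by apply/seteqP; split=> // w _; have [->|] := eqVneq w 1; [right|move=> /eqP; left].
pose Z : set (X * discrete GP) := [set z | z.2 = 1 :> GP] `|` (B `*` W).
have mZ : measurable Z.
  apply: measurableU; last exact: measurableX.
  rewrite (_ : [set _ | _] = setT `*` [set (1 : GP) : discrete GP]).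
    exact: measurable_slice.
  by apply/seteqP; split=> [z|z []].
have [||Y [mY ZY _ smi]] := mkSMI _ mZ.
- by move=> x; left.
- have one_w x k l w : all_good (fun v => cm_good (m v)) pr x -> B x ->
      k = gp_gen e (w : G u) * gp_gen e g -> w <> 1 -> (psi l (x, k)).2 <> 1 :> GP.
    move=> gx [_ Bx] kE w1 lk; apply: w1.
    apply: (psi_sep v u g 1 w l x k) => //.
    by rewrite lk invg1 mul1g gp_gen1 mul1g.
  move=> l [x k] /= gx; have gx' := psi_good l (x, k) gx.
  case E : (psi l (x, k)) => [x' k'].
  rewrite E /= in gx'; have E2 : (psi l (x, k)).2 = k' by rewrite E.
  have Vl : psi l^-1 (x', k') = (x, k) by rewrite -E psiVK.
  (* Mixed pairs are excluded by [one_w], used with [l^-1] when the point of [B * W] is the target.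
     For points over [w g] and [w' g] the cocycle value is [g^-1 (w'^-1 w) g], so [w = w'] and
     freeness gives [l = 1]. *)
  move=> [/= k1|[/= Bx [w w1 wk]]] [/= k'1|[/= Bx' [w' w'1 wk']]].
  + by apply: (psi_free l x k) => //; rewrite E2 k1.
  + by exfalso; apply: (one_w x' k' l^-1 w') => //; rewrite Vl.
  + by exfalso; apply: (one_w x k l w) => //; rewrite E2.
  + apply: (psi_free l x k) => //; rewrite E2 -wk -wk'.
    have /mulg1_eq : w'^-1 * w = 1.
      apply: (psi_sep v u g g^-1 _ l x k) => //; first by case: Bx.
      by rewrite E2 -wk -wk' invgM gp_genM !gp_genV !mulgA.
    by rewrite invgK => ->.
suff -> : +oo%E = nu Y by [].
apply/esym/eqP; rewrite -leye_eq -(nu_oo B W mB infW QB).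
apply: le_measure; rewrite ?inE//; first exact: measurableX.
by apply: subset_trans ZY => z Wz; right.
Qed.

End GraphProductSMI.

Local Close Scope group_scope.

(* [V_single]: for a one-vertex graph the graph products are the vertex groups
   themselves, and an index strictly between 1 and +oo need not jump to +oo. *)
Theorem theoremB (R : realType) (V : finType) (e : rel V)
  (H G : V -> groupType) (c : V -> \bar R)
  (e_sym : symmetric e) (e_irr : irreflexive e)
  (V_gt0 : (0 < #|V|)%N)
  (e_irred : irreducible_graph e)
  (H_ntriv : forall v, nontrivial (H v))
  (H_fg : forall v, finitely_generated (H v))
  (G_ntriv : forall v, nontrivial (G v))
  (G_fg : forall v, finitely_generated (G v))
  (HG_SMI : forall v, SMI (H v) (G v) (c v))
  (V_single : #|V| = 1%N -> forall v, c v = 1 \/ c v = +oo) :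
  (~ (forall v, c v = 1) ->
     SMI (graph_product e H) (graph_product e G) (+oo : \bar R)) /\
  ((forall v, c v = 1) ->
     SMI (graph_product e H) (graph_product e G) (1 : \bar R)).
Proof.
have cH v : countable [set: H v] by exact: countable_fg.
have cG v : countable [set: G v] by exact: countable_fg.
have infG v : infinite_set [set: G v].
  by case: (SMI_cocycle_model (cH v) (cG v) (HG_SMI v)).
have exm v : exists _ : cocycle_model (H v) (G v) (c v), True.
  by case: (SMI_cocycle_model (cH v) (cG v) (HG_SMI v)) => _ [m]; exists m.
pose m v := sval (cid (exm v)).
split=> [/existsNP[v cv]|c1]; last exact: (graph_product_SMI1 e_sym e_irr cH cG infG V_gt0 m c1).
have [V1|V1] := eqVneq #|V| 1%N; last first.
  have [u uv evu] := irreducible_nonadjacent v e_sym e_irred V1.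
  exact: (graph_product_SMIoo e_sym e_irr cH cG infG V_gt0 m cv uv evu).
(* No second vertex [u] is available here; [V_single] makes the index [+oo], and the given coupling
   is transported along the isomorphisms with the vertex groups. *)
have [w Vw] : exists w : V, all_equal_to w by apply/fintype1P; rewrite V1.
have Vv (u : V) : u = v by rewrite (Vw u) (Vw v).
have coo : c v = +oo by case: (V_single V1 v).
rewrite -coo.
apply: SMI_isomorphic (HG_SMI v).
- exact: (single_vertexM (A := H) e_irr Vv).
- exact: single_vertex_bij.
- exact: (single_vertexM (A := G) e_irr Vv).
- exact: single_vertex_bij.
Qed.
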